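(* Let $Q \subseteq \mathbb{R}^d$ be a cube, $r \in [1,\infty)$, $s \in (0,1)$ and $f \in F^{s}_{1,r}(Q)$. For a cube $R$ define $$f_{R}^{s,r}(x):=\left(\int_R \frac{|f(x)-f(y)|^r}{|x-y|^{d+sr}}\,dy\right)^{1/r}, \qquad x \in R.$$ Then there exists a sparse collection $\mathcal{S}\subseteq \mathcal{D}(Q)$ such that for a.e. $x \in Q$ $$f_{Q}^{s,r}(x) \lesssim_d \sum_{R\in\mathcal{S}} \left( \big\langle f_{3R}^{s,r}\big\rangle_R + \frac1{s^{1+1/r}\cdot \ell(R)^s}\cdot \big\langle|f-\langle f\rangle_R|\big\rangle_R \right)\mathbf{1}_R(x) .$$
   Context: Cubes have sides parallel to the coordinate axes; $\ell(R)$ is the side length of $R$; $3R$ is the cube with the same center as $R$ and side length $3\ell(R)$. $\mathcal{D}(Q)$ is the collection of all dyadic subcubes of $Q$ (including $Q$), obtained by repeatedly bisecting the sides. $\langle f\rangle_R:=\frac1{|R|}\int_R f$. A collection $\mathcal{S}$ of cubes is sparse if for every $R\in\mathcal{S}$ there is a measurable $E_R\subseteq R$ with $|E_R|\ge\frac12|R|$ such that the sets $E_R$, $R\in\mathcal{S}$, are pairwise disjoint. $F^s_{1,r}(Q)$ is the space of all $f\in L^1(Q)$ (complex-valued) with $[f]_{F^s_{1,r}(Q)}:=\int_Q\left(\int_Q\frac{|f(x)-f(y)|^r}{|x-y|^{d+sr}}\,dy\right)^{1/r}dx<\infty$. Convention: whenever a function $g$ defined on $Q$ is integrated over a region outside $Q$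 (e.g. in $f^{s,r}_{3R}$ when $3R\not\subseteq Q$), $g$ is replaced by its $2\ell(Q)$-periodic extension obtained by even reflection across the faces of $Q$: if $Q=\prod_{j=1}^d[a_j,a_j+\ell(Q)]$, for $x\in\mathbb{R}^d$ let $y_j\in[0,2\ell(Q))$ with $x_j=a_j+y_j \bmod 2\ell(Q)$, put $x_j^*=a_j+\ell(Q)-|y_j-\ell(Q)|$, and define the extension by $\tilde g(x)=g(x^* )$. $A\lesssim_{d}B$ means $A\le C\,B$ with a constant $C>0$ depending only on $d$. *)

(* Defs.v *)
From HB Require Import structures.
From mathcomp Require Import all_boot all_order all_algebra.
From mathcomp Require Import all_classical all_reals all_analysis.
From mathcomp Require Import complex lra.

Set Implicit Arguments.
Unset Strict Implicit.
Unset Printing Implicit Defensive.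

Import Order.TTheory GRing.Theory Num.Theory.
Import numFieldNormedType.Exports.
Import ComplexField.Normc.

Local Open Scope classical_set_scope.
Local Open Scope ring_scope.

(* The measurable structure of tuples is the product sigma-algebra, here the
   Borel sigma-algebra of R^n. *)
Notation Rn R n := (n.-tuple (measurableTypeR R)).

(* Lebesgue measure on R^n is the product of n copies of the Lebesgue measure of
   the line, transported along R * R^n -> R^(n+1). *)
Section lebesgue_cons.
Context {R : realType} {n : nat}.

Definition cons_pair (p : measurableTypeR R * Rn R n) : Rn R n.+1 :=
  [the n.+1.-tuple (measurableTypeR R) of p.1 :: p.2].

Lemma measurable_cons_pair : measurable_fun [set: _] cons_pair.
Proof. exact: measurable_cons. Qed.

Variable mu : {sigma_finite_measure set (Rn R n) -> \bar R}.

Definition lebesgue_cons : set (Rn R n.+1) -> \bar R :=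
  pushforward (lebesgue_measure \x mu)%E cons_pair.

Let lebesgue_cons0 : lebesgue_cons set0 = 0%E.
Proof. by rewrite /lebesgue_cons /pushforward preimage_set0 measure0. Qed.

Let lebesgue_cons_ge0 A : (0 <= lebesgue_cons A)%E.
Proof. by rewrite /lebesgue_cons /pushforward measure_ge0. Qed.

Let lebesgue_cons_sigma_additive : semi_sigma_additive lebesgue_cons.
Proof.
move=> F mF tF mUF; rewrite /lebesgue_cons /pushforward preimage_bigcup.
have mpre A : measurable A -> measurable (cons_pair @^-1` A).
  by move=> mA; rewrite -[X in measurable X]setTI; exact: measurable_cons_pair.
apply: measure_semi_sigma_additive.
- by move=> k; exact: mpre.
- apply/trivIsetP => /= i j _ _ ij; rewrite -preimage_setI.
  by move/trivIsetP : tF => /(_ _ _ _ _ ij) ->//; rewrite preimage_set0.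
- by rewrite -preimage_bigcup; exact: mpre.
Qed.

HB.instance Definition _ := isMeasure.Build _ _ _ lebesgue_cons
  lebesgue_cons0 lebesgue_cons_ge0 lebesgue_cons_sigma_additive.

Lemma lebesgue_consX (A : set (measurableTypeR R)) (B : set (Rn R n)) :
  measurable A -> measurable B ->
  lebesgue_cons [set x | A (thead x) /\ B [tuple of behead x]] =
  (lebesgue_measure A * mu B)%E.
Proof.
move=> mA mB; rewrite -product_measure1E//; congr ((_ \x _)%E _).
apply/seteqP; split => -[t v] /=; rewrite theadE.
  move=> -[? ?]; split => //.
  by rewrite [v](_ : _ = behead_tuple (cons_tuple t v))//; apply: val_inj.
move=> -[? Bv]; split => //.
by rewrite [X in B X](_ : _ = v)//; apply: val_inj.
Qed.

Lemma measurable_consX (A : set (measurableTypeR R)) (B : set (Rn R n)) :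
  measurable A -> measurable B ->
  measurable [set x : Rn R n.+1 | A (thead x) /\ B [tuple of behead x]].
Proof.
move=> mA mB; apply: measurableI.
  rewrite -[X in measurable X]setTI.
  exact: (@measurable_tnth _ (measurableTypeR R) n.+1 ord0).
rewrite -[X in measurable X]setTI.
exact: (@measurable_behead _ (measurableTypeR R) n).
Qed.

Let lebesgue_cons_sigma_finite : sigma_finite setT lebesgue_cons.
Proof.
have /sigma_finiteP[F [FT Fnd Foo]] :=
  sigma_finiteT (@lebesgue_measure R).
have /sigma_finiteP[G [GT Gnd Goo]] := sigma_finiteT mu.
exists (fun k => [set x | F k (thead x) /\ G k [tuple of behead x]]).
  apply/seteqP; split => // x _.
  have [i _ Fi] : (\bigcup_i F i) (thead x) by rewrite -FT.
  have [j _ Gj] : (\bigcup_i G i) [tuple of behead x] by rewrite -GT.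
  exists (maxn i j) => //=; split.
    by move: (thead x) Fi; apply/subsetPset/Fnd/leq_maxl.
  by move: Gj; apply/subsetPset/Gnd/leq_maxr.
move=> k; have [mF Fk] := Foo k; have [mG Gk] := Goo k; split.
  exact: measurable_consX.
by rewrite lebesgue_consX//; apply: lte_mul_pinfty => //; rewrite ge0_fin_numE.
Qed.

HB.instance Definition _ := Measure_isSigmaFinite.Build _ _ _ lebesgue_cons
  lebesgue_cons_sigma_finite.

End lebesgue_cons.

Fixpoint lebesgue_Rn (R : realType) (n : nat) :
    {sigma_finite_measure set (Rn R n) -> \bar R} :=
  match n with
  | 0%N => \d_([tuple] : Rn R 0)
  | n'.+1 => lebesgue_cons (lebesgue_Rn R n')
  end.
Arguments lebesgue_Rn {R} n.

Section boxes.
Context {R : realType}.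

Definition coord {n} (x : Rn R n) (i : 'I_n) : R := tnth x i.

Definition box {n} (a b : Rn R n) : set (Rn R n) :=
  [set x | forall i, coord a i <= coord x i <= coord b i].

Lemma box_cons n (a b : Rn R n.+1) :
  box a b = [set x | [set` `[thead a, thead b]] (thead x) /\
                     box [tuple of behead a] [tuple of behead b]
                         [tuple of behead x]].
Proof.
have tB (x : Rn R n.+1) i :
    tnth [tuple of behead x] i = tnth x (lift ord0 i).
  by rewrite [in RHS](tuple_eta x) tnthS.
apply/seteqP; split => x.
  move=> abx; split; first by rewrite /= in_itv/=; exact: (abx ord0).
  by move=> i; rewrite /coord !tB; exact: abx.
move=> -[]; rewrite /= in_itv /= => x0 xS i.
have [j ->|->//] := unliftP ord0 i.
by have := xS j; rewrite /coord !tB.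
Qed.

Lemma measurable_box n (a b : Rn R n) : measurable (box a b).
Proof.
elim: n a b => [|n IH] a b; last by rewrite box_cons; exact: measurable_consX.
by rewrite (_ : box a b = setT)//; apply/seteqP; split => // x _ [].
Qed.

Lemma lebesgue_Rn_box n (a b : Rn R n) :
  (forall i, coord a i <= coord b i) ->
  lebesgue_Rn n (box a b) = (\prod_(i < n) (coord b i - coord a i))%:E.
Proof.
elim: n a b => [|n IH] a b ab.
  rewrite big_ord0 /= /dirac indicE mem_set// => -[]//.
rewrite box_cons big_ord_recl.
rewrite [LHS](@lebesgue_consX _ _ (lebesgue_Rn n))//; last first.
  exact: measurable_box.
have tB (x : Rn R n.+1) i :
    tnth [tuple of behead x] i = tnth x (lift ord0 i).
  by rewrite [in RHS](tuple_eta x) tnthS.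
rewrite IH; last by move=> i; rewrite /coord !tB; exact: ab.
rewrite lebesgue_measure_itv/= lte_fin EFinM; congr (_ * _)%E.
  case: ltP => [_|ba]; first by rewrite EFinB.
  by rewrite (_ : coord b ord0 = coord a ord0) ?subrr//; apply/eqP;
    rewrite eq_le ba ab.
by congr (_%:E); apply: eq_bigr => i _; rewrite /coord !tB.
Qed.

End boxes.

Record cube (R : realType) (d : nat) := Cube {
  corner : Rn R d ; (* the vertex with the smallest coordinates *)
  side : {posnum R}
}.

HB.instance Definition _ (R : realType) (d : nat) :=
  gen_eqMixin (cube R d).
HB.instance Definition _ (R : realType) (d : nat) :=
  gen_choiceMixin (cube R d).

Section cubes.
Context {R : realType} {d : nat}.
Implicit Types (P Q : cube R d) (S : set (cube R d)).

Definition cube_set Q : set (Rn R d) :=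
  [set x | forall i, coord (corner Q) i <= coord x i
                     <= coord (corner Q) i + (side Q)%:num].

Definition volume Q : \bar R := lebesgue_Rn d (cube_set Q).

(* [b] selects the lower or the upper half in each coordinate. Cubes are closed,
   so the 2^d halves of a cube overlap in a null set. *)
Definition half Q (b : 'I_d -> bool) : cube R d :=
  Cube [tuple coord (corner Q) i + (if b i then (side Q)%:num / 2 else 0)
       | i < d] ((side Q)%:num / 2)%:pos.

Lemma volumeE Q : volume Q = ((side Q)%:num ^+ d)%:E.
Proof.
pose b : Rn R d := [tuple coord (corner Q) i + (side Q)%:num | i < d].
have bE i : coord b i = coord (corner Q) i + (side Q)%:num.
  by rewrite /coord tnth_mktuple.
have -> : volume Q = lebesgue_Rn d (box (corner Q) b).
  congr (lebesgue_Rn d _); apply/seteqP.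
  by split => x xQ i; have := xQ i; rewrite bE.
rewrite lebesgue_Rn_box => [|i]; last by rewrite bE lerDl.
rewrite (eq_bigr (fun=> (side Q)%:num)) => [|i _]; last by rewrite bE addrC addKr.
by rewrite prodr_const card_ord.
Qed.

Inductive dyadic Q : cube R d -> Prop :=
| dyadic_self : dyadic Q Q
| dyadic_half P b : dyadic Q P -> dyadic Q (half P b).

Definition triple Q : cube R d :=
  Cube [tuple coord (corner Q) i - (side Q)%:num | i < d]
       (3 * (side Q)%:num)%:pos.

Definition sparse S : Prop :=
  exists E : cube R d -> set (Rn R d),
    (forall P, S P -> [/\ measurable (E P), E P `<=` cube_set P &
                          (2^-1%:E * volume P <= lebesgue_Rn d (E P))%E]) /\
    trivIset S E.

End cubes.

Section functions.
Context {R : realType} {d : nat}.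
Implicit Types (P Q : cube R d) (f : Rn R d -> R[i]).

(* The Euclidean distance, not the maximum-norm distance of the library. *)
Definition edist (x y : Rn R d) : R :=
  Num.sqrt (\sum_(i < d) (coord x i - coord y i) ^+ 2).

(* f_P^{s,r}(x); on the diagonal y = x, a null set, the integrand is 0. *)
Definition frac_grad (s r : R) P f (x : Rn R d) : \bar R :=
  ((\int[lebesgue_Rn d]_(y in cube_set P)
     (normc (f x - f y) `^ r / edist x y `^ (d%:R + s * r))%:E)
   `^ r^-1)%E.

(* f \in L^1(Q); two functions that agree almost everywhere on [Q] represent
   the same element, and every element has a Borel representative. *)
Definition L1 Q f : Prop :=
  (lebesgue_Rn d).-integrable (cube_set Q) (EFin \o (fun x => complex.Re (f x))) /\
  (lebesgue_Rn d).-integrable (cube_set Q) (EFin \o (fun x => complex.Im (f x))).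

Definition F_seminorm (s r : R) Q f : \bar R :=
  (\int[lebesgue_Rn d]_(x in cube_set Q) frac_grad s r Q f x)%E.

Definition F_space (s r : R) Q f : Prop :=
  L1 Q f /\ (F_seminorm s r Q f < +oo)%E.

(* <f>_P *)
Definition cmean P f : R[i] :=
  Complex
    ((\int[lebesgue_Rn d]_(x in cube_set P) complex.Re (f x)) / fine (volume P))
    ((\int[lebesgue_Rn d]_(x in cube_set P) complex.Im (f x)) / fine (volume P)).

(* <g>_P for g >= 0, possibly infinite *)
Definition emean P (g : Rn R d -> \bar R) : \bar R :=
  ((\int[lebesgue_Rn d]_(x in cube_set P) g x) / volume P)%E.

(* x |-> x^*: folds R^d onto [Q] by even reflection across the faces of [Q]. *)
Definition fold Q (x : Rn R d) : Rn R d :=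
  let l := (side Q)%:num in
  [tuple let a := coord (corner Q) i in
         let t := coord x i - a in
         let y := t - 2 * l * (Num.floor (t / (2 * l)))%:~R in
         a + l - `|y - l|
  | i < d].

Lemma fold_id Q x : cube_set Q x -> fold Q x = x.
Proof.
move=> Qx; apply: eq_from_tnth => i; rewrite tnth_mktuple; cbv zeta.
have /andP[ax xal] := Qx i; set a := coord _ _ in ax xal *.
have l0 : 0 < (side Q)%:num :> R by exact: gt0.
set l := (side Q)%:num in xal l0 *.
have -> : Num.floor ((coord x i - a) / (2 * l)) = 0.
  apply/eqP; rewrite floor_eq add0r; apply/andP; split.
    by rewrite divr_ge0 ?subr_ge0 ?mulr_ge0 ?(ltW l0).
  by rewrite ltr_pdivrMr ?mulr_gt0//; lra.
rewrite mulr0 subr0 ler0_norm; last by rewrite /=; lra.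
by rewrite /= -[tnth x i]/(coord x i); lra.
Qed.

Definition reflect_ext Q f : Rn R d -> R[i] := f \o fold Q.

End functions.

(* Main.v *)
(** Write [g_P = f_{3P}^{s,r}] and [u_P = |f - <f>_P|].  Starting from [Q], a
    dyadic [T] inside a selected cube [P] is selected when it is maximal with
    [<g_P>_T > 4 <g_P>_P] or [<u_P>_T > 4 <u_P>_P]; by the weak-type (1,1) bound
    these [T] fill at most half of [P], which gives sparseness.  Almost every
    point of the remaining part of [P] satisfies [g_P <= 4 <g_P>_P] and
    [u_P <= 4 <u_P>_P].
      From [P] to the next selected [T] around [x], split [3P] into [3T] and the
    rest.  On the rest, compare [f x - f y] with [f z - f y] for every [z] in [T]
    and average over [z]: with [q = 1/r],
      [g_P x <= g_T x + A (s^-q l(T)^-s (u_T x + <u_T>_T) + <g_P>_T)],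
    and similarly [u_P x <= u_T x + <u_T>_T + <u_P>_T].  The potential
      [g_P x + 2 A s^(-1-q) l(P)^-s u_P x]
    then telescopes along the selected cubes containing [x]: since
    [1 - 2^-s >= s/2], the growth of [l^-s] from [P] to [T] absorbs the term in
    [u_T x].  This is where the factor [s^(-1-q)] comes from.
      All inequalities are between extended reals, and an infinite mean over [P]
    selects nothing, so no finiteness has to be checked along the way. *)

Require Import Defs.
From mathcomp Require Import all_boot all_order all_algebra.
From mathcomp Require Import all_classical all_reals all_analysis.
From mathcomp Require Import measurable_realfun complex ring lra.

Import Order.TTheory GRing.Theory Num.Theory.
Import numFieldNormedType.Exports.
Import ComplexField.Normc.

Local Open Scope classical_set_scope.
Local Open Scope ring_scope.

Set Implicit Arguments.
Unset Strict Implicit.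
Unset Printing Implicit Defensive.

Local Notation coord := Defs.coord.
Local Notation half := Defs.half.
Local Notation edist := Defs.edist.

(** * Half-open dyadic cubes and their descendants around a point *)

Section halfopen.
Context {R : realType} {d : nat}.
Implicit Types (P Q T : cube R d) (x y : Rn R d).

(* Half-open cubes: the halves of [P] partition [hcube P] exactly, and
   [cube_set P] only differs from it by a null set. *)
Definition hcube P : set (Rn R d) :=
  [set x | forall i, coord (corner P) i <= coord x i
                     < coord (corner P) i + (side P)%:num].

Lemma side_gt0 P : 0 < (side P)%:num :> R.
Proof. exact: gt0. Qed.

Definition bits x P : {ffun 'I_d -> bool} :=
  [ffun i => coord (corner P) i + (side P)%:num / 2 <= coord x i].

(** For [x] in [hcube P] this is the child of [P] around [x], so [iter n (sub x) P] is the dyadic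
    descendant of generation [n] around [x]. Dyadic cubes are mostly addressed through points in
    this way. *)
Definition sub x P : cube R d := half P (bits x P).

Lemma coord_half P (b : 'I_d -> bool) i :
  coord (corner (half P b)) i =
  coord (corner P) i + (if b i then (side P)%:num / 2 else 0).
Proof. by rewrite /coord tnth_mktuple. Qed.

Lemma hcube_sub x P : hcube P x -> hcube (sub x P) x.
Proof.
move=> Px i; have /andP[] := Px i.
rewrite coord_half ffunE /=; have := side_gt0 P.
by case: ifPn; rewrite -?ltNge => *; apply/andP; split; lra.
Qed.

Lemma hcube_half P (b : 'I_d -> bool) : hcube (half P b) `<=` hcube P.
Proof.
move=> x Px i; have /andP[] := Px i; rewrite coord_half /=.
have := side_gt0 P.
by case: ifPn => *; apply/andP; split; lra.
Qed.

Lemma sub_half x P (b : {ffun 'I_d -> bool}) :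
  hcube (half P b) x -> sub x P = half P b.
Proof.
move=> Px; congr half; congr fun_of_fin; apply/ffunP => i; rewrite ffunE.
have /andP[] := Px i; rewrite coord_half /=.
have := side_gt0 P.
by case: ifPn => _ ?; rewrite ?addr0 => ? ?;
  [apply/idP|apply/negbTE; rewrite -ltNge]; lra.
Qed.

Lemma half_finfun P (b : 'I_d -> bool) : half P b = half P [ffun i => b i].
Proof.
by congr Cube; apply: eq_from_tnth => i; rewrite !tnth_mktuple ffunE.
Qed.

Lemma trivIset_halves P :
  trivIset setT (fun b : {ffun 'I_d -> bool} => hcube (half P b)).
Proof.
move=> b c _ _ [x [bx cx]]; apply/ffunP => i.
have := sub_half bx; rewrite (sub_half cx) => /(congr1 (@corner _ _)).
move=> /(congr1 (coord^~ i)); rewrite !coord_half; have := side_gt0 P.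
by case: (b i); case: (c i) => //= ? ?; exfalso; lra.
Qed.

Lemma hcube_iter x P n : hcube P x -> hcube (iter n (sub x) P) x.
Proof. by move=> Px; elim: n => //= n IH; exact: hcube_sub. Qed.

(** The nesting of dyadic cubes. In the induction, [sub_half] recovers a child from any of its
    points, so a cube of the chain of [x] that contains [y] is also in the chain of [y]. *)
Lemma iter_subP x y P n : hcube P x -> hcube (iter n (sub x) P) y ->
  hcube P y /\ iter n (sub y) P = iter n (sub x) P.
Proof.
move=> Px; elim: n y => //= n IH y Py.
have [Py' e] := IH _ (hcube_half Py).
by split => //; rewrite e; exact: sub_half.
Qed.

Lemma side_iter x P n : (side (iter n (sub x) P))%:num = (side P)%:num / 2 ^+ n.
Proof.
by elim: n => [|n /= ->]; rewrite ?expr0 ?divr1// exprS invfM; ring.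
Qed.

Lemma iter_sub_inj x y P m n :
  iter m (sub x) P = iter n (sub y) P -> m = n.
Proof.
move=> /(congr1 (fun T => (side T)%:num)); rewrite !side_iter => e.
have l0 : (side P)%:num != 0 :> R by exact: lt0r_neq0.
have {e} e : 2 ^+ m = 2 ^+ n :> R.
  by apply: invr_inj; apply: (mulfI l0).
apply/eqP; rewrite eqn_leq -!(ler_eXn2l (ltr1n R 2)) // e lexx.
by [].
Qed.

Lemma dyadic_trans P Q T : dyadic P Q -> dyadic Q T -> dyadic P T.
Proof. by move=> PQ; elim=> // T' b _; exact: dyadic_half. Qed.

Lemma dyadic_iter x P n : dyadic P (iter n (sub x) P).
Proof. by elim: n => [|n IH] /=; [exact: dyadic_self|exact: dyadic_half]. Qed.

Lemma hcube_dyadic P T : dyadic P T -> hcube T `<=` hcube P.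
Proof.
by elim=> // P' b _; apply: subset_trans; exact: hcube_half.
Qed.

Lemma hcube_corner P : hcube P (corner P).
Proof. by move=> i; rewrite lexx ltrDl /=. Qed.

Lemma hcube_sub_cube P : hcube P `<=` cube_set P.
Proof. by move=> x Px i; have /andP[-> /ltW] := Px i. Qed.

Lemma cube_set_half P (b : 'I_d -> bool) : cube_set (half P b) `<=` cube_set P.
Proof.
move=> x Px i; have /andP[] := Px i; rewrite coord_half /=.
have := side_gt0 P.
by case: ifPn => *; apply/andP; split; lra.
Qed.

Lemma cube_set_dyadic P T : dyadic P T -> cube_set T `<=` cube_set P.
Proof.
by elim=> // P' b _; apply: subset_trans; exact: cube_set_half.
Qed.

Lemma measurable_coord (i : 'I_d) : measurable_fun [set: Rn R d] (coord^~ i).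
Proof. exact: (@measurable_tnth _ (measurableTypeR R)). Qed.

Lemma measurable_cube_set P : measurable (cube_set P).
Proof.
pose b : Rn R d := [tuple coord (corner P) i + (side P)%:num | i < d].
have -> : cube_set P = box (corner P) b; last exact: measurable_box.
have bE i : coord b i = coord (corner P) i + (side P)%:num.
  by rewrite /coord tnth_mktuple.
by apply/seteqP; split=> x Px i; have := Px i; rewrite bE.
Qed.

Lemma measurable_hcube P : measurable (hcube P).
Proof.
have -> : hcube P = \bigcap_(i in [set: 'I_d]) (coord^~ i @^-1`
    [set` `[coord (corner P) i, coord (corner P) i + (side P)%:num[%R]).
  apply/seteqP; split => x Px i; first by move=> _; rewrite /= in_itv/=; exact: Px.
  by have := Px i I; rewrite /= in_itv.
apply: fin_bigcap_measurable => // i _; rewrite -[X in measurable X]setTI.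
by apply: measurable_coord => //; exact: measurable_itv.
Qed.

(** The difference is covered by the [d] upper faces. The box from [a i] to [b] is the face in
    direction [i]: its side in that direction is zero, hence so is its volume. *)
Lemma negligible_cubeD P : (lebesgue_Rn d).-negligible (cube_set P `\` hcube P).
Proof.
pose a i : Rn R d := [tuple coord (corner P) j +
   (if j == i then (side P)%:num else 0) | j < d].
pose b : Rn R d := [tuple coord (corner P) i + (side P)%:num | i < d].
have aE i j : coord (a i) j =
    coord (corner P) j + (if j == i then (side P)%:num else 0).
  by rewrite /coord tnth_mktuple.
have bE i : coord b i = coord (corner P) i + (side P)%:num.
  by rewrite /coord tnth_mktuple.
apply: (@negligibleS _ _ _ _ (\big[setU/set0]_(i < d) box (a i) b)).
  move=> x [Px /existsNP[i /negP]]; rewrite -bigcup_seq => xi.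
  exists i; first by rewrite /= mem_index_enum.
  have {xi} xi : coord x i = coord (corner P) i + (side P)%:num.
    move: xi; have /andP[-> /=] := Px i; rewrite -leNgt => ? ?.
    by apply/eqP; rewrite eq_le; apply/andP.
  move=> j; rewrite aE bE.
  case: eqP => [->|_]; first by rewrite xi !lexx.
  by rewrite addr0; exact: Px.
apply: big_ind => [|A B|i _]; [exact: negligible_set0|exact: negligibleU|].
apply/negligibleP; first exact: measurable_box.
apply: etrans (lebesgue_Rn_box _) _ => [j|].
  by rewrite aE bE; case: ifP => // _; rewrite addr0 lerDl.
rewrite (bigD1 i) //= aE bE eqxx subrr mul0r //.
Qed.

Lemma lebesgue_hcube P : lebesgue_Rn d (hcube P) = ((side P)%:num ^+ d)%:E.
Proof.
rewrite -volumeE /volume.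
have mD : measurable (cube_set P `\` hcube P).
  by apply: measurableD; [exact: measurable_cube_set|exact: measurable_hcube].
have -> : cube_set P = hcube P `|` (cube_set P `\` hcube P).
  by rewrite setDUK//; exact: hcube_sub_cube.
rewrite measureU//; last 2 first.
  exact: measurable_hcube.
  by rewrite setDIK.
rewrite (_ : _ (_ `\` _) = 0%E) ?adde0//.
by apply/negligibleP => //; exact: negligible_cubeD.
Qed.

End halfopen.

(** * Unions of the dyadic subcubes with a given property *)

Section hit.
Context {R : realType} {d : nat}.
Implicit Types (P Q T : cube R d) (phi psi : set (cube R d)).
Local Notation mu := (lebesgue_Rn d : {measure set (Rn R d) -> \bar R}).

(** The union of the dyadic descendants of [P] in [phi], or equally the disjoint union of the
    maximal ones. Its truncation [hit_upto] at generation [n] allows inductions that descend from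
    [P] and stop at the first cube in [phi]. *)
Definition hit phi P : set (Rn R d) :=
  [set x | hcube P x /\ exists n, phi (iter n (sub x) P)].

Definition hit_upto phi n P : set (Rn R d) :=
  [set x | hcube P x /\ exists2 k, (k <= n)%N & phi (iter k (sub x) P)].

Lemma hit_sub phi P : hit phi P `<=` hcube P.
Proof. by move=> x []. Qed.

Lemma hit_bigcup phi P : hit phi P = \bigcup_n hit_upto phi n P.
Proof.
apply/seteqP; split => [x [Px [n ?]]|x [n _ [Px [k _ ?]]]].
  by exists n => //; split=> //; exists n.
by split=> //; exists k.
Qed.

Lemma hit_upto_top phi n P : phi P -> hit_upto phi n P = hcube P.
Proof.
by move=> phiP; apply/seteqP; split => [x []//|x Px]; split=> //; exists 0%N.
Qed.

Lemma hit_upto0 phi P : ~ phi P -> hit_upto phi 0 P = set0.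
Proof.
move=> phiP; apply/seteqP; split=> // x [_ [k]].
by rewrite leqn0 => /eqP ->.
Qed.

Lemma hit_uptoS phi n P : ~ phi P -> hit_upto phi n.+1 P =
  \big[setU/set0]_(b : {ffun 'I_d -> bool}) hit_upto phi n (half P b).
Proof.
move=> phiP; rewrite -bigcup_seq; apply/seteqP; split=> x.
  move=> [Px [[|k] kn]]; first by move=> /phiP.
  rewrite iterSr => ?; exists (bits x P); first by rewrite /= mem_index_enum.
  by split; [exact: hcube_sub|exists k].
move=> [b _ [bx [k kn phik]]]; split; first exact: hcube_half bx.
by exists k.+1 => //; rewrite iterSr (sub_half bx).
Qed.

Lemma measurable_hit_upto phi n P : measurable (hit_upto phi n P).
Proof.
elim: n P => [|n IH] P; (have [phiP|phiP] := pselect (phi P);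
    first by rewrite hit_upto_top//; exact: measurable_hcube).
  by rewrite hit_upto0.
by rewrite hit_uptoS//; exact: bigsetU_measurable.
Qed.

Lemma measurable_hit phi P : measurable (hit phi P).
Proof.
by rewrite hit_bigcup; apply: bigcup_measurable => n _; exact: measurable_hit_upto.
Qed.

Section compare.
Variables g h : Rn R d -> \bar R.
Hypotheses (mg : measurable_fun setT g) (mh : measurable_fun setT h).
Hypotheses (g0 : forall x, (0 <= g x)%E) (h0 : forall x, (0 <= h x)%E).

(** The recursion stops at the maximal cubes in [phi], where the assumption applies; the halves are
    disjoint, so the integrals add up. *)
Lemma le_integral_hit_upto phi n P :
  (forall T, dyadic P T -> phi T ->
    (\int[mu]_(x in hcube T) g x <= \int[mu]_(x in hcube T) h x)%E) ->
  (\int[mu]_(x in hit_upto phi n P) g x <= \int[mu]_(x in hit_upto phi n P) h x)%E.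
Proof.
elim: n P => [|n IH] P gh; (have [phiP|phiP] := pselect (phi P);
    first by rewrite hit_upto_top//; apply: gh => //; exact: dyadic_self).
  by rewrite hit_upto0// !integral_set0.
have tr : trivIset [set` index_enum {ffun 'I_d -> bool}]
    (fun b : {ffun 'I_d -> bool} => hit_upto phi n (half P b)).
  move=> b c _ _ [x [[bx _] [cx _]]]; apply: (@trivIset_halves R d P) => //.
  by exists x.
rewrite hit_uptoS// !ge0_integral_bigsetU//; last 6 first.
- by move=> b; exact: measurable_hit_upto.
- exact: index_enum_uniq.
- exact: measurable_funS mh.
- by move=> b; exact: measurable_hit_upto.
- exact: index_enum_uniq.
- exact: measurable_funS mg.
apply: lee_sum => b _; apply: IH => T bT; apply: gh.
by apply: dyadic_trans bT; apply: dyadic_half; exact: dyadic_self.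
Qed.

Lemma le_integral_hit phi P :
  (forall T, dyadic P T -> phi T ->
    (\int[mu]_(x in hcube T) g x <= \int[mu]_(x in hcube T) h x)%E) ->
  (\int[mu]_(x in hit phi P) g x <= \int[mu]_(x in hit phi P) h x)%E.
Proof.
move=> gh; have nd : nondecreasing_seq (fun n => hit_upto phi n P).
  move=> m n mn; rewrite subsetEset => x [Px [k km ?]].
  by split=> //; exists k => //; exact: leq_trans mn.
have lim k : measurable_fun [set: Rn R d] k -> (forall x, (0 <= k x)%E) ->
    (\int[mu]_(x in hit_upto phi n P) k x)%E @[n --> \oo] -->
    (\int[mu]_(x in \bigcup_n hit_upto phi n P) k x)%E.
  move=> mk k0; apply: ge0_nondecreasing_set_cvg_integral => //.
    by move=> n; exact: measurable_hit_upto.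
  by move=> n; exact: measurable_funS mk.
rewrite hit_bigcup; apply: lee_cvg_to (lim _ mg g0) (lim _ mh h0) _.
by apply: nearW => n; exact: le_integral_hit_upto.
Qed.

End compare.

Lemma le_measure_hit (A : set (Rn R d)) (c : R) phi P :
  measurable A -> 0 <= c ->
  (forall T, dyadic P T -> phi T ->
    (mu (A `&` hcube T) <= c%:E * mu (hcube T))%E) ->
  (mu (A `&` hit phi P) <= c%:E * mu (hit phi P))%E.
Proof.
move=> mA c0 AT.
rewrite -integral_indic//; last exact: measurable_hit.
rewrite -integral_cst; last exact: measurable_hit.
apply: le_integral_hit => //.
- by apply/measurable_EFinP; exact: measurable_indic.
- move=> T PT phiT; rewrite integral_indic//; last exact: measurable_hcube.
  by rewrite integral_cst ?AT//; exact: measurable_hcube.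
Qed.

End hit.

(** * Means over cubes and the weak-type bound *)

Section means.
Context {R : realType} {d : nat}.
Implicit Types (P Q T : cube R d) (g : Rn R d -> \bar R).
Local Notation mu := (lebesgue_Rn d : {measure set (Rn R d) -> \bar R}).

Definition vol P : R := (side P)%:num ^+ d.

Lemma vol_gt0 P : 0 < vol P.
Proof. by rewrite exprn_gt0 ?side_gt0. Qed.

Lemma emean_ge0 P g : (forall x, (0 <= g x)%E) -> (0 <= emean P g)%E.
Proof.
move=> g0; rewrite /emean mule_ge0//; first by apply: integral_ge0 => x _.
by rewrite inve_ge0 volumeE lee_fin ltW// vol_gt0.
Qed.

Lemma integral_cube_set P g : measurable_fun setT g -> (forall x, (0 <= g x)%E) ->
  (\int[mu]_(x in cube_set P) g x = \int[mu]_(x in hcube P) g x)%E.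
Proof.
move=> mg g0; have mD : measurable (cube_set P `\` hcube P).
  by apply: measurableD; [exact: measurable_cube_set|exact: measurable_hcube].
rewrite (@ge0_negligible_integral _ _ _ _ _ (cube_set P `\` hcube P))//.
- by rewrite setDD setIC (setIidl (@hcube_sub_cube _ _ P)).
- exact: measurable_cube_set.
- exact: measurable_funS mg.
- by apply/negligibleP => //; exact: negligible_cubeD.
Qed.

Lemma emeanE P g : measurable_fun setT g -> (forall x, (0 <= g x)%E) ->
  (emean P g = (\int[mu]_(x in hcube P) g x) * (vol P)^-1%:E)%E.
Proof.
move=> mg g0; rewrite /emean integral_cube_set// volumeE inver.
by rewrite gt_eqF ?vol_gt0.
Qed.

Lemma integral_hcube P g : measurable_fun setT g -> (forall x, (0 <= g x)%E) ->
  (\int[mu]_(x in hcube P) g x = emean P g * (vol P)%:E)%E.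
Proof.
move=> mg g0; rewrite emeanE// -muleA -EFinM mulVf ?mule1//.
by rewrite gt_eqF ?vol_gt0.
Qed.

(** A half has [2^-d] of the volume. This controls the mean over a selected cube by the mean over
    its parent. *)
Lemma emean_half P (b : 'I_d -> bool) g : measurable_fun setT g ->
  (forall x, (0 <= g x)%E) ->
  (emean (half P b) g <= (2 ^+ d)%:E * emean P g)%E.
Proof.
move=> mg g0; rewrite !emeanE// muleCA -EFinM.
have -> : 2 ^+ d / vol P = (vol (half P b))^-1.
  by rewrite /vol /= exprMn invfM exprVn invrK mulrC.
apply: lee_wpmul2r; first by rewrite lee_fin invr_ge0 ltW// vol_gt0.
apply: ge0_subset_integral => //; try exact: measurable_hcube.
  exact: measurable_funS mg.
exact: hcube_half.
Qed.

(** For a finite positive mean [a], every selected [T] has [4 a |T| <= \int_T g]; adding up over the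
    maximal ones gives [4 a |hit| <= \int_P g = a |P|]. If the mean is zero or infinite, nothing is
    selected. *)
Lemma weak_type g P : measurable_fun setT g -> (forall x, (0 <= g x)%E) ->
  (mu (hit [set T | 4%:E * emean P g < emean T g] P) <=
   (4^-1)%:E * mu (hcube P))%E.
Proof.
move=> mg g0; set phi := [set T | _].
have e0 : (0 <= emean P g)%E by exact: emean_ge0.
have Pge0 : (0 <= (4^-1)%:E * mu (hcube P))%E.
  by rewrite mule_ge0 // lee_fin invr_ge0.
have hit0 : (forall T, dyadic P T -> ~ phi T) -> mu (hit phi P) = 0%E.
  move=> phi0; rewrite (_ : hit phi P = set0) ?measure0//.
  apply/seteqP; split=> // x [_ [n]]; apply: phi0; exact: dyadic_iter.
have [a0|] := eqVneq (emean P g) 0%E.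
  rewrite hit0// => T PT; rewrite /phi /= a0 mule0; apply/negP; rewrite -leNgt.
  rewrite emeanE// mule_le0_ge0// ?lee_fin ?invr_ge0 ?(ltW (vol_gt0 _))//.
  rewrite -(mul0e (vol P)%:E) -a0 -integral_hcube//.
  apply: ge0_subset_integral => //; try exact: measurable_hcube.
    exact: measurable_funS mg.
  exact: hcube_dyadic.
have intP := integral_hcube P mg g0.
move: intP hit0 e0; rewrite {}/phi; case: (emean P g) => [a| |] //; last first.
  move=> _ hit0 _ _; rewrite hit0// => T _ /=.
  by rewrite gt0_muley ?lte_fin//; apply/negP; rewrite -leNgt leey.
move=> intP _; rewrite lee_fin le_eqVlt eq_sym => /orP[/eqP ->|a0 _].
  by rewrite eqxx.
set phi := [set T | _].
have mhit : measurable (hit phi P) by exact: measurable_hit.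
have : ((4 * a)%:E * mu (hit phi P) <= a%:E * (vol P)%:E)%E.
  rewrite -integral_cst// -intP.
  apply: (@le_trans _ _ (\int[mu]_(x in hit phi P) g x)%E); last first.
    apply: ge0_subset_integral => //; first exact: measurable_hcube.
      exact: measurable_funS mg.
    exact: hit_sub.
  apply: le_integral_hit => //.
    by move=> x; rewrite lee_fin mulr_ge0// ltW.
  move=> T PT /ltW phiT; rewrite integral_cst; last exact: measurable_hcube.
  rewrite integral_hcube// [X in (_ * X)%E]lebesgue_hcube.
  by rewrite EFinM; apply: lee_wpmul2r => //; rewrite lee_fin ltW// vol_gt0.
rewrite [mu (hcube P)]lebesgue_hcube -/(vol P).
rewrite muleC -lee_pdivlMr ?mulr_gt0// => /le_trans; apply.
rewrite -!EFinM lee_fin le_eqVlt; apply/orP; left; apply/eqP; field.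
by rewrite gt_eqF.
Qed.

End means.

(** * Dyadic cubes generate the Borel sets of a cube *)

Section dyadic_generation.
Context {R : realType} {d : nat}.
Implicit Types (P : cube R d) (X Y : set (Rn R d)).

(** The unions of dyadic subcubes of [P] of one common generation. They form a ring, because two
    such sets can be brought to the finer of their generations. *)
Definition level_sets P : set (set (Rn R d)) :=
  [set X | X `<=` hcube P /\ exists n, forall x y, hcube P x -> hcube P y ->
     iter n (sub x) P = iter n (sub y) P -> X x -> X y].

Lemma iter_sub_le x y P m n : (m <= n)%N ->
  hcube P x -> hcube P y ->
  iter n (sub x) P = iter n (sub y) P -> iter m (sub x) P = iter m (sub y) P.
Proof.
move=> mn Px Py e; have y1 : hcube (iter m (sub x) P) y.
  apply: (@hcube_dyadic _ _ _ (iter n (sub x) P)); last by rewrite e; exact: hcube_iter.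
  by rewrite -(subnK mn) iterD; exact: dyadic_iter.
by have [_ ->] := iter_subP Px y1.
Qed.

Lemma setring_level_sets P : setring (level_sets P).
Proof.
split.
- by split=> //; exists 0%N.
- move=> X Y [XP [m Xm]] [YP [n Yn]]; split; first by move=> x [/XP|/YP].
  exists (maxn m n) => x y Px Py e [Xx|Yx]; [left|right].
    by apply: (Xm x y) => //; apply: iter_sub_le e => //; exact: leq_maxl.
  by apply: (Yn x y) => //; apply: iter_sub_le e => //; exact: leq_maxr.
- move=> X Y [XP [m Xm]] [YP [n Yn]]; split; first by move=> x [/XP].
  exists (maxn m n) => x y Px Py e [Xx Yx]; split.
    by apply: (Xm x y) => //; apply: iter_sub_le e => //; exact: leq_maxl.
  move=> Yy; apply: Yx; apply: (Yn y x) => //.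
  by apply/esym; apply: iter_sub_le e => //; exact: leq_maxr.
Qed.

Lemma level_sets_hcube P : level_sets P (hcube P).
Proof. by split=> //; exists 0%N. Qed.

Lemma level_sets_hit P X m :
  (X `<=` hcube P) -> (forall x y, hcube P x -> hcube P y ->
     iter m (sub x) P = iter m (sub y) P -> X x -> X y) ->
  X = hit [set C | exists2 x, X x & C = iter m (sub x) P] P.
Proof.
move=> XP Xm; apply/seteqP; split=> [x Xx|y [Py [k [x Xx]]]].
  by split; [exact: XP|exists m, x].
move=> e; have km := iter_sub_inj e; rewrite km in e.
by apply: (Xm x y) => //; exact: XP.
Qed.

Lemma small_cube_side P (e : R) : 0 < e -> exists n, (side P)%:num / 2 ^+ n < e.
Proof.
move=> e0; exists (Num.bound ((side P)%:num / e)).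
rewrite ltr_pdivrMr ?exprn_gt0// -ltr_pdivrMl// mulrC.
apply: lt_le_trans (archi_boundP (ltW (divr_gt0 (side_gt0 P) e0))) _.
by rewrite -natrX ler_nat ltnW// ltn_expl.
Qed.

(** If coordinate [i] of [x] exceeds [c], so does that of the corner of a small enough dyadic cube
    around [x]. The trace of the half-space is therefore the union of the level sets [X n]. *)
Lemma level_sets_ray P (i : 'I_d) (c : R) :
  <<sr level_sets P>> (hcube P `&` (coord^~ i @^-1` `]c, +oo[)).
Proof.
pose X n := [set x | hcube P x /\ c < coord (corner (iter n (sub x) P)) i].
have -> : hcube P `&` (coord^~ i @^-1` `]c, +oo[) = \bigcup_n X n.
  apply/seteqP; split=> x; last first.
    move=> [n _ [Px cx]]; split=> //=; rewrite in_itv/= andbT.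
    by have /andP[xl _] := hcube_iter n Px i; exact: lt_le_trans xl.
  move=> [Px]; rewrite /= in_itv/= andbT => cx.
  have [n nc] : exists n, (side P)%:num / 2 ^+ n < coord x i - c.
    by apply: small_cube_side; rewrite subr_gt0.
  exists n => //; split=> //; have /andP[_] := hcube_iter n Px i.
  by rewrite side_iter; lra.
have [_ _ SU] : sigma_ring <<sr level_sets P>> by exact: smallest_sigma_ring.
apply: SU => n.
suff : level_sets P (X n) by exact: sub_gen_smallest.
split; first by move=> x [].
by exists n => x y _ Py e [_ cx]; split=> //; rewrite -e.
Qed.

(** The sets whose trace on [hcube P] lies in the sigma-ring form a sigma-algebra, as complements
    can be taken inside [hcube P]. It contains the half-spaces of [level_sets_ray], and these
    generate the Borel sets. *)
Lemma measurable_level_sets P Y :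
  measurable Y -> <<sr level_sets P>> (hcube P `&` Y).
Proof.
have [S0 SD SU] : sigma_ring <<sr level_sets P>> by exact: smallest_sigma_ring.
have SP : <<sr level_sets P>> (hcube P).
  by apply: sub_gen_smallest; exact: level_sets_hcube.
have sC : sigma_algebra setT [set Y | <<sr level_sets P>> (hcube P `&` Y)].
  split => /=.
  - by rewrite setI0.
  - move=> A PA; rewrite setTD -[_ `&` ~` A]/(_ `\` A).
    rewrite -[_ `\` A]set0U -(setDv (hcube P)) -setDIr; exact: SD.
  - by move=> F PF; rewrite setI_bigcupr; exact: SU.
suff : (measurable : set (set (Rn R d))) `<=`
    [set Y | <<sr level_sets P>> (hcube P `&` Y)] by apply.
apply: smallest_sub => // {}Y.
rewrite -bigcup_seq => -[i _ [B mB <-{Y}]]; rewrite setTI.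
have sP : sigma_algebra setT
    [set B | <<sr level_sets P>> (hcube P `&` (coord^~ i @^-1` B))].
  have [C0 CD CU] := sC; split => /=.
  - by rewrite preimage_set0 setI0.
  - by move=> A PA; have := CD _ PA; rewrite !setTD.
  - by move=> F PF; rewrite preimage_bigcup; exact: CU.
suff : (@RGenOInfty.G R).-sigma.-measurable `<=`
    [set B | <<sr level_sets P>> (hcube P `&` (coord^~ i @^-1` B))].
  by apply; rewrite -RGenOInfty.measurableE.
by apply: smallest_sub => // _ [c ->]; exact: level_sets_ray.
Qed.

End dyadic_generation.

(** * Points with bounded dyadic means *)

(* A substitute for Lebesgue's differentiation theorem.  On the set [A] where all
   dyadic means of [g] are at most [l], the inequality
   [\int_(A `&` X) g <= l * mu (A `&` X)] holds for finite unions [X] of dyadic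
   cubes, hence for every Borel [X] by the monotone class theorem; take for [X]
   the set where [g >= l + 1/(k+1)]. *)
Section differentiation.
Context {R : realType} {d : nat}.
Implicit Types (P T : cube R d) (X Y : set (Rn R d)).
Local Notation mu := (lebesgue_Rn d : {measure set (Rn R d) -> \bar R}).
Variables (g : Rn R d -> \bar R) (l : R) (P : cube R d).
Hypotheses (mg : measurable_fun setT g) (g0 : forall x, (0 <= g x)%E).
Hypothesis l0 : 0 <= l.

Let small X := (\int[mu]_(x in X) g x <= l%:E * mu X)%E.

(** Only generations up to [m] are tested, so that [A_ m] is a union of cubes of generation [m]; [A]
    is the decreasing limit. *)
Let A_ m := [set x | hcube P x /\
  forall n, (n <= m)%N -> (emean (iter n (sub x) P) g <= l%:E)%E].

Let A := \bigcap_m A_ m.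

Let mA_ m : measurable (A_ m).
Proof.
have -> : A_ m = hcube P `\` hit_upto [set T | (l%:E < emean T g)%E] m P.
  apply/seteqP; split=> x [Px]; first move=> xm; last move=> /not_andP[]// xm.
    by split=> // -[_ [k km /=]]; apply/negP; rewrite -leNgt; exact: xm.
  split=> // n nm; rewrite leNgt; apply/negP => lt; apply: xm.
  by exists n.
by apply: measurableD; [exact: measurable_hcube|exact: measurable_hit_upto].
Qed.

Let mA : measurable A.
Proof. by apply: bigcapT_measurable. Qed.

Let mu_fin X : X `<=` hcube P -> measurable X -> (mu X < +oo)%E.
Proof.
move=> XP mX; apply: le_lt_trans (le_measure mu _ _ XP) _; rewrite ?inE//.
  exact: measurable_hcube.
by rewrite [ltLHS]lebesgue_hcube ltry.
Qed.

Let small_bigcap (X : (set (Rn R d))^nat) : nonincreasing_seq X ->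
  (forall n, measurable (X n)) -> (forall n, X n `<=` hcube P) ->
  (forall n, small (X n)) -> small (\bigcap_n X n).
Proof.
move=> niX mX XP sX; have mcap : measurable (\bigcap_n X n).
  exact: bigcapT_measurable.
have lim : (l%:E * mu (X n))%E @[n --> \oo] --> (l%:E * mu (\bigcap_n X n))%E.
  by apply: cvgeZl => //; apply: nonincreasing_cvg_mu => //; exact: mu_fin.
apply: cvge_to_ge lim _; apply: nearW => n; apply: le_trans (sX n).
apply: ge0_subset_integral => //; first exact: measurable_funS mg.
exact: bigcap_inf.
Qed.

Let small_bigcup (X : (set (Rn R d))^nat) : nondecreasing_seq X ->
  (forall n, measurable (X n)) ->
  (forall n, small (X n)) -> small (\bigcup_n X n).
Proof.
move=> ndX mX sX; have mcup : measurable (\bigcup_n X n).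
  exact: bigcup_measurable.
have lim : (\int[mu]_(x in X n) g x)%E @[n --> \oo] -->
    (\int[mu]_(x in \bigcup_n X n) g x)%E.
  by apply: ge0_nondecreasing_set_cvg_integral => // n; exact: measurable_funS mg.
apply: cvge_le lim; apply: nearW => n; apply: le_trans (sX n) _.
rewrite lee_wpmul2l ?lee_fin// le_measure ?inE//.
exact: bigcup_sup.
Qed.

(** A half-open cube of generation [m] lies in [A_ m] or is disjoint from it, and in the first case
    its own mean is at most [l]. [le_integral_hit] adds up these cubes. *)
Let small_level m X : (X `<=` hcube P) -> (forall x y, hcube P x -> hcube P y ->
     iter m (sub x) P = iter m (sub y) P -> X x -> X y) ->
  measurable X /\ small (A_ m `&` X).
Proof.
move=> XP Xm; split; first by rewrite (level_sets_hit XP Xm); exact: measurable_hit.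
have AXP : A_ m `&` X `<=` hcube P by move=> x [_ /XP].
rewrite /small (@level_sets_hit _ _ P (A_ m `&` X) m)//; last first.
  move=> x y Px Py e [[_ Ax] Xx]; split; last exact: (Xm x y).
  split=> // n nm; have -> : iter n (sub y) P = iter n (sub x) P.
    by apply: iter_sub_le (esym e).
  exact: Ax.
rewrite -integral_cst; last exact: measurable_hit.
apply: le_integral_hit => //.
move=> T PT [x [[_ Ax] Xx] ->].
rewrite integral_cst; last exact: measurable_hcube.
rewrite integral_hcube// [X in (_ <= _ * X)%E]lebesgue_hcube.
apply: lee_wpmul2r; first by rewrite lee_fin ltW// vol_gt0.
exact: Ax.
Qed.

Let AP : A `<=` hcube P.
Proof. by move=> x /(_ 0%N I)[]. Qed.

Let small_level_set X : level_sets P X -> measurable X /\ small (A `&` X).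
Proof.
move=> [XP [n Xn]]; have [mX _] := small_level XP Xn; split=> //.
(* A union of cubes of generation [n] is also one of generation [m + n], so [small_level] applies to
   each term of this decreasing intersection. *)
have -> : A `&` X = \bigcap_m (A_ (m + n)%N `&` X).
  apply/seteqP; split=> [x [Ax Xx] m _|x Ax].
    by split=> //; exact: Ax.
  split; last by have [] := Ax 0%N I.
  move=> m _; have [[Px Am] _] := Ax m I; split=> // k km.
  by apply: Am; rewrite (leq_trans km)// leq_addr.
apply: small_bigcap.
- move=> i j ij; rewrite subsetEset => x [[Px Ax] Xx]; split=> //; split=> // k ki.
  by apply: Ax; rewrite (leq_trans ki)// leq_add2r.
- by move=> i; exact: measurableI.
- by move=> i x [_ /XP].
- move=> i; have [] // := @small_level (i + n)%N X => // x y Px Py e.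
  by apply: (Xn x y) => //; apply: iter_sub_le e => //; exact: leq_addl.
Qed.

Let small_measurable X : measurable X -> small (A `&` X).
Proof.
move=> mX; suff : <<sr level_sets P>> `<=` [set X | measurable X /\ small (A `&` X)].
  by move=> /(_ _ (measurable_level_sets mX))[_]; rewrite setIA (setIidl AP).
apply: monotone_setring_sub_g_sigma_ring.
- split=> [F ndF mF|F niF mF]; (split; first by
      (apply: bigcup_measurable || apply: bigcapT_measurable) => i; have [] := mF i).
    rewrite setI_bigcupr; apply: small_bigcup => [i j ij|i|i].
    - by rewrite subsetEset; apply: setIS; rewrite -subsetEset; exact: ndF.
    - by apply: measurableI => //; have [] := mF i.
    - by have [] := mF i.
  have -> : A `&` \bigcap_i F i = \bigcap_i (A `&` F i).
    apply/seteqP; split=> [x [Ax Fx] i _|x AF]; first by split=> //; exact: Fx.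
    by split=> [|i _]; [have [] := AF 0%N I|have [] := AF i I].
  apply: small_bigcap => [i j ij|i|i|i].
  - by rewrite subsetEset; apply: setIS; rewrite -subsetEset; exact: niF.
  - by apply: measurableI => //; have [] := mF i.
  - by move=> x [/AP].
  - by have [] := mF i.
- exact: setring_level_sets.
- by move=> Y /small_level_set.
Qed.

Lemma negligible_gt_dyadic_means : mu.-negligible [set x | hcube P x /\
  (forall n, emean (iter n (sub x) P) g <= l%:E)%E /\ (l%:E < g x)%E].
Proof.
pose B k := A `&` [set x | ((l + k.+1%:R^-1)%:E <= g x)%E].
have mB k : measurable (B k).
  apply: measurableI => //; rewrite -[X in measurable X]setTI.
  exact: emeasurable_fun_c_infty.
apply: (@negligibleS _ _ _ _ (\bigcup_k B k)); last first.
  apply: negligible_bigcup => k; apply/negligibleP => //.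
  suff : mu (B k) = 0%E by [].
  have Bfin : (mu (B k) < +oo)%E by apply: mu_fin => // x [/AP].
  (* On [B k] the function is at least [l + 1/(k+1)], yet its integral is at most [l * mu (B k)]. As
     this measure is finite, it must vanish. *)
  have : ((l + k.+1%:R^-1)%:E * mu (B k) <= l%:E * mu (B k))%E.
    apply: (@le_trans _ _ (\int[mu]_(x in B k) g x)%E); last first.
      apply: small_measurable; rewrite -[X in measurable X]setTI.
      exact: emeasurable_fun_c_infty.
    rewrite -integral_cst//; apply: ge0_le_integral => //.
    - by move=> x _; rewrite lee_fin addr_ge0.
    - exact: measurable_funS mg.
    - by move=> x [].
  have : (0 <= mu (B k))%E by [].
  move: Bfin; case: (mu (B k)) => //= m _; rewrite lee_fin => m0.
  rewrite -!EFinM lee_fin mulrDl gerDl pmulr_rle0// => m0'.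
  by congr EFin; apply/eqP; rewrite eq_le m0 m0'.
move=> x [Px [Ax lx]]; have Ax' : A x by move=> m _; split=> // n _; exact: Ax.
have [k lk] : exists k, ((l + k.+1%:R^-1)%:E <= g x)%E.
  case: (g x) (g0 x) lx => [r| |] //; last by move=> _ _; exists 0%N; rewrite leey.
  move=> _; rewrite lte_fin => lr; exists (Num.bound (r - l)^-1).
  rewrite lee_fin -lerBrDl invf_ple ?posrE ?subr_gt0//.
  have rl : 0 <= (r - l)^-1 by rewrite invr_ge0 subr_ge0 ltW.
  by rewrite (le_trans (ltW (archi_boundP rl)))// ler_nat.
by exists k => //; split.
Qed.

End differentiation.

(** * The cubes selected by a stopping rule [bad] *)

Section stopping_family.
Context {R : realType} {d : nat}.
Implicit Types (P T : cube R d) (x y : Rn R d).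
Local Notation mu := (lebesgue_Rn d : {measure set (Rn R d) -> \bar R}).
Variables (Q : cube R d) (bad : cube R d -> set (cube R d)).

(* The smallest selected cube among the first [n] dyadic descendants of [Q]
   containing [x]. *)
Fixpoint anc x n : cube R d :=
  if n is m.+1 then
    let T := iter n (sub x) Q in if `[< bad (anc x m) T >] then T else anc x m
  else Q.

Lemma anc_local x y n : hcube Q x -> hcube Q y ->
  iter n (sub x) Q = iter n (sub y) Q -> anc x n = anc y n.
Proof.
move=> Qx Qy; elim: n => [//|n IH] e.
rewrite [LHS]/= [RHS]/= -!iterS e IH//; exact: iter_sub_le e.
Qed.

(** [bad P T] asks that [T] be selected below the selected cube [P]. A cube is selected when it is
    its own smallest selected ancestor. *)
Definition stopping : set (cube R d) :=
  [set P | exists x n, [/\ hcube Q x, P = iter n (sub x) Q & anc x n = P]].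

(** For a selected [P], the points that lie in no further selected cube. *)
Definition last_piece P := hcube P `\` hit (bad P) P.

Lemma stopping_top : stopping Q.
Proof. by exists (corner Q), 0%N; split=> //; exact: hcube_corner. Qed.

Lemma stopping_dyadic : stopping `<=` dyadic Q.
Proof. by move=> _ [x [n [_ -> _]]]; exact: dyadic_iter. Qed.

Lemma stopping_hcube P x : stopping P -> hcube P x ->
  exists n, P = iter n (sub x) Q /\ anc x n = P.
Proof.
move=> [y [n [Qy Pn an]]] Px; rewrite Pn in Px.
have [Qx e] := iter_subP Qy Px; exists n; rewrite e; split=> //.
by rewrite (anc_local Qx Qy e).
Qed.

Lemma anc_stays P x n : P = iter n (sub x) Q -> anc x n = P ->
  forall m, (forall j, (j <= m)%N -> ~ bad P (iter j (sub x) P)) ->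
  anc x (m + n) = P.
Proof.
move=> Pn an; elim=> [//|m IH] nb; rewrite addSn /=.
rewrite IH => [|j jm]; last by apply: nb; exact: leqW.
rewrite iterD -Pn ifF//; apply/negbTE/asboolPn; exact: (nb m.+1).
Qed.

Lemma anc_stopping x n : hcube Q x -> stopping (anc x n).
Proof.
move=> Qx; elim: n => [|n IH]; first exact: stopping_top.
rewrite /=; case: ifPn => // b.
by exists x, n.+1; split=> //=; rewrite b.
Qed.

(** No dyadic descendant of [P] around [x] is bad, so the sequence [anc x] stays at [P]. Its
    eventual value determines [P], which makes the pieces disjoint. *)
Lemma last_pieceP P x : stopping P -> last_piece P x ->
  exists n, forall m, anc x (m + n) = P.
Proof.
move=> SP [Px nhit]; have [n [Pn an]] := stopping_hcube SP Px.
exists n => m; apply: (anc_stays Pn an) => j _ bj; apply: nhit.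
by split=> //; exists j.
Qed.

Lemma trivIset_last_piece : trivIset stopping last_piece.
Proof.
move=> P T SP ST [x [Px Tx]].
have [m Pm] := last_pieceP SP Px; have [n Tn] := last_pieceP ST Tx.
by rewrite -(Pm n) addnC Tn.
Qed.

(** The first bad cube around [x] is selected, because [anc x] stays at [P] until it is reached. *)
Lemma hit_bad_stopping P : stopping P ->
  hit (bad P) P `<=` hit (bad P `&` stopping) P.
Proof.
move=> SP x [Px [k]].
elim/ltn_ind: k => k IH bk; have [n [Pn an]] := stopping_hcube SP Px.
have Qx : hcube Q x by apply: hcube_dyadic Px; exact: stopping_dyadic.
have [[j jk bj]|nb] := pselect (exists2 j, (j < k)%N & bad P (iter j (sub x) P)).
  exact: IH bj.
split=> //; exists k; split=> //.
case: k => [//|k] in IH bk nb *.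
exists x, (k.+1 + n)%N; split=> //; first by rewrite iterD -Pn.
rewrite addSn /= (anc_stays Pn an) => [|j jk bj]; last by apply: nb; exists j.
by rewrite iterD -Pn ifT//; apply/asboolP.
Qed.

Lemma measurable_last_piece P : measurable (last_piece P).
Proof. by apply: measurableD; [exact: measurable_hcube|exact: measurable_hit]. Qed.

(** Countability of the dyadic cubes: each is coded by a finite word of halvings. Numbers that code
    no word give [Q]. *)
Definition dyadic_enum (k : nat) : cube R d :=
  foldr (fun (b : {ffun 'I_d -> bool}) P => half P b) Q
    (odflt [::] (unpickle k)).

Lemma dyadic_enumP P : dyadic Q P -> exists k, P = dyadic_enum k.
Proof.
suff: dyadic Q P -> exists s : seq {ffun 'I_d -> bool},
    P = foldr (fun (b : {ffun 'I_d -> bool}) P => half P b) Q s.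
  by move=> /[apply] -[s ->]; exists (pickle s); rewrite /dyadic_enum pickleK.
elim=> [|T b _ [s ->]]; first by exists [::].
by exists ([ffun i => b i] :: s); rewrite /= half_finfun.
Qed.

Hypothesis bad_small : forall P,
  (mu (hit (bad P) P) <= (2^-1)%:E * mu (hcube P))%E.

(** The set attached to [P] is [last_piece P]; it misses only [hit (bad P) P], which is at most half
    of [P]. *)
Lemma sparse_stopping : sparse stopping.
Proof.
exists last_piece; split; last exact: trivIset_last_piece.
move=> P _; split; first exact: measurable_last_piece.
  by move=> x [/hcube_sub_cube].
rewrite volumeE -lebesgue_hcube.
have -> : (2^-1%:E * mu (hcube P) =
    mu (hcube P) - 2^-1%:E * mu (hcube P))%E.
  rewrite [mu _]lebesgue_hcube -!EFinM -EFinB; congr EFin.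
  by rewrite -/(vol P); lra.
rewrite leeBlDr; last by rewrite [X in (_ * X)%E]lebesgue_hcube.
apply: (@le_trans _ _ (mu (last_piece P) + mu (hit (bad P) P))%E); last first.
  by rewrite leeD2l.
rewrite -measureU//; last 3 first.
- exact: measurable_last_piece.
- exact: measurable_hit.
- by rewrite /last_piece setDE -setIA setICl setI0.
by rewrite /last_piece setUC setDUK//; exact: hit_sub.
Qed.

Let unsettled := [set x | hcube Q x /\ forall P, stopping P -> ~ last_piece P x].

Let measurable_unsettled : measurable unsettled.
Proof.
have -> : unsettled = hcube Q `\`
    \bigcup_k (if `[< stopping (dyadic_enum k) >] then last_piece (dyadic_enum k)
               else set0).
  apply/seteqP; split=> x [Qx nx]; split=> //.
    by move=> [k _]; case: asboolP => // /nx.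
  move=> P SP Px; have [k Pk] := dyadic_enumP (stopping_dyadic SP).
  by apply: nx; exists k => //; rewrite -Pk asboolT.
apply: measurableD; first exact: measurable_hcube.
by apply: bigcupT_measurable => k; case: ifP => // _; exact: measurable_last_piece.
Qed.

(* The points [x] that belong to infinitely many selected cubes; by induction on
   [k], they fill at most the fraction [2^-k] of every selected cube. *)
Lemma negligible_no_last_piece :
  mu.-negligible [set x | hcube Q x /\ forall P, stopping P -> ~ last_piece P x].
Proof.
rewrite -/unsettled.
have half_pow k P : stopping P ->
    (mu (unsettled `&` hcube P) <= (2^-1 ^+ k)%:E * mu (hcube P))%E.
  elim: k P => [|k IH] P SP.
    rewrite expr0 mul1e; apply: le_measure; rewrite ?inE//.
      by apply: measurableI => //; exact: measurable_hcube.
    exact: measurable_hcube.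
  apply: (@le_trans _ _ (mu (unsettled `&` hit (bad P `&` stopping) P))).
    apply: le_measure; rewrite ?inE.
    - by apply: measurableI => //; exact: measurable_hcube.
    - by apply: measurableI => //; exact: measurable_hit.
    move=> x [[Qx bx] Px]; split=> //; apply: hit_bad_stopping => //.
    by have := bx _ SP => /not_andP[]// /contrapT.
  apply: le_trans (@le_measure_hit _ _ unsettled (2^-1 ^+ k) _ _ _ _ _) _ => //.
    by move=> T _ [_ /IH].
  rewrite exprSr EFinM -muleA; apply: lee_wpmul2l; first by rewrite lee_fin exprn_ge0.
  apply: le_trans (bad_small P); apply: le_measure; rewrite ?inE.
  - exact: measurable_hit.
  - exact: measurable_hit.
  - by move=> x [Px [n [bn _]]]; split=> //; exists n.
apply/negligibleP => //.
have : (forall k, mu unsettled <= (2^-1 ^+ k)%:E * mu (hcube Q))%E.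
  move=> k; have := half_pow k Q stopping_top.
  by rewrite (setIidl _)// => x [].
rewrite [mu (hcube Q)]lebesgue_hcube -/(vol Q) => le0.
apply/eqP; rewrite eq_le; apply/andP; split; last by [].
have lim : ((2^-1 ^+ k)%:E * (vol Q)%:E)%E @[k --> \oo] --> (0 * (vol Q)%:E)%E.
  apply: cvgeZr => //; apply: cvg_EFin; first exact: nearW.
  by apply: cvg_expr; rewrite ger0_norm ?invr_ge0// invf_lt1// ltr1n.
by rewrite mul0e in lim; apply: cvge_to_ge lim (nearW _ le0).
Qed.

End stopping_family.

(** * Arithmetic of one telescoping step *)

Section telescoping_arithmetic.
Context {R : realType}.
Local Open Scope ereal_scope.

Lemma ge0_addye (x : \bar R) : 0 <= x -> +oo + x = +oo.
Proof. by case: x. Qed.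

Lemma ge0_addey (x : \bar R) : 0 <= x -> x + +oo = +oo.
Proof. by case: x. Qed.

(* One step [P -> T] for the potential [g + 2 A c u], where [c] is the weight
   [s^(-1-1/r) l^-s]: the hypothesis [s c1 + 2 c <= 2 c1] lets the increase of
   the weight pay for the term [A s c1 u1]. *)
Lemma potential_step (g u g1 u1 a b a1 b1 : \bar R) (A K s c c1 : R) :
  (1 <= A)%R -> (1 <= K)%R -> (0 < s)%R -> (0 < c)%R -> (0 < c1)%R ->
  (s * c1 + 2 * c <= 2 * c1)%R ->
  0 <= g1 -> 0 <= u1 -> 0 <= a -> 0 <= b -> 0 <= a1 -> 0 <= b1 ->
  u <= u1 + b1 + K%:E * b ->
  g <= g1 + A%:E * ((s * c1)%:E * (u1 + b1) + K%:E * a) ->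
  g + (2 * A * c)%:E * u <= g1 + (2 * A * c1)%:E * u1 +
     (2 * A * K)%:E * ((a + c%:E * b) + (a1 + c1%:E * b1)).
Proof.
move=> A1 K1 s0 c0 c10 scc g10 u10 a0 b0 a10 b10 uu' gg'.
have A0 : (0 < A)%R by lra.
have K0 : (0 < K)%R by lra.
have AK0 : (0 < 2 * A * K)%R by rewrite !mulr_gt0.
have Ac0 : (0 < 2 * A * c1)%R by rewrite !mulr_gt0.
have nneg (k : R) x : (0 < k)%R -> 0 <= x -> 0 <= k%:E * x.
  by move=> k0 x0; rewrite mule_ge0// lee_fin ltW.
have co := nneg _ _ c0 b0; have co' := nneg _ _ c10 b10.
have w0 : 0 <= a + c%:E * b by exact: adde_ge0.
have w'0 : 0 <= a1 + c1%:E * b1 by exact: adde_ge0.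
have ww0 := adde_ge0 w0 w'0.
have Aww := nneg _ _ AK0 ww0; have Au := nneg _ _ Ac0 u10.
have gu0 := adde_ge0 g10 Au.
(* If one of the six terms on the right is infinite, so is the whole right-hand side; the cases
   below remove them one by one. *)
move: g10 gg' gu0; case: g1 => [g1| |] // g10 gg' gu0; last by rewrite !ge0_addye// leey.
move: u10 uu' gg' Au gu0; case: u1 => [u1| |] // u10 uu' gg' Au gu0; last first.
  by rewrite gt0_muley ?lte_fin// ge0_addey// ge0_addye// leey.
move: a0 w0 ww0 Aww gg'; case: a => [a| |] // a0 w0 ww0 Aww gg'; last first.
  by rewrite (ge0_addye co) (ge0_addye w'0) gt0_muley ?lte_fin// ge0_addey// leey.
move: b0 co w0 ww0 Aww uu'; case: b => [b| |] // b0 co w0 ww0 Aww uu'; last first.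
  rewrite (gt0_muley (x := c%:E)) ?lte_fin// (ge0_addey a0) (ge0_addye w'0).
  by rewrite gt0_muley ?lte_fin// ge0_addey// leey.
move: b10 co' w'0 ww0 Aww uu' gg'.
case: b1 => [b1| |] // b10 co' w'0 ww0 Aww uu' gg'; last first.
  rewrite (gt0_muley (x := c1%:E)) ?lte_fin// (ge0_addey a10) (ge0_addey w0).
  by rewrite gt0_muley ?lte_fin// ge0_addey// leey.
move: a10 w'0 ww0 Aww; case: a1 => [a1| |] // a10 w'0 ww0 Aww; last first.
  rewrite (ge0_addye co') (ge0_addey w0) gt0_muley ?lte_fin// ge0_addey// leey//.
rewrite !lee_fin in g10 u10 a0 b0 b10 a10.
rewrite -!(EFinM, EFinD) in uu'; rewrite -!(EFinM, EFinD) in gg'.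
rewrite -!(EFinM, EFinD).
apply: (@le_trans _ _ (g1 + A * (s * c1 * (u1 + b1) + K * a) +
    (2 * A * c) * (u1 + b1 + K * b))%R%:E).
  rewrite EFinD; apply: leeD => //; rewrite [leRHS]EFinM; apply: lee_wpmul2l => //.
  by rewrite lee_fin !mulr_ge0// ltW.
rewrite lee_fin.
have h1 : (A * u1 * (s * c1 + 2 * c) <= A * u1 * (2 * c1))%R.
  by rewrite ler_wpM2l// mulr_ge0// ltW.
have h2 : (A * b1 * (s * c1 + 2 * c) <= A * b1 * (2 * c1))%R.
  by rewrite ler_wpM2l// mulr_ge0// ltW.
have h3 : (A * c1 * b1 <= A * c1 * b1 * K)%R.
  by rewrite ler_peMr// !mulr_ge0// ltW.
have h4 : (0 <= A * K * a)%R by rewrite !mulr_ge0// ltW.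
have h5 : (0 <= A * K * a1)%R by rewrite !mulr_ge0// ltW.
lra.
Qed.

End telescoping_arithmetic.

(** * Sparse domination for abstract [g] and [u] *)

Section sparse_domination.
Context {R : realType} {d : nat}.
Implicit Types (P T : cube R d) (x y : Rn R d).
Local Notation mu := (lebesgue_Rn d : {measure set (Rn R d) -> \bar R}).
Local Open Scope ereal_scope.
Variables (Q : cube R d) (g u : cube R d -> Rn R d -> \bar R).
Variables (c : cube R d -> R) (A s : R).
Hypotheses (A1 : (1 <= A)%R) (s0 : (0 < s)%R) (c0 : forall P, (0 < c P)%R).
Hypotheses (mg : forall P, measurable_fun setT (g P))
  (mu_ : forall P, measurable_fun setT (u P)).
Hypotheses (g0 : forall P x, 0 <= g P x) (u0 : forall P x, 0 <= u P x).
Hypothesis c_iter : forall P T x n,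
  T = iter n.+1 (sub x) P -> (s * c T + 2 * c P <= 2 * c T)%R.
Hypothesis u_iter : forall P T x n, hcube P x -> T = iter n.+1 (sub x) P ->
  u P x <= u T x + emean T (u T) + emean T (u P).
Hypothesis g_iter : forall P T x n, hcube P x -> T = iter n.+1 (sub x) P ->
  g P x <= g T x + A%:E * ((s * c T)%:E * (u T x + emean T (u T)) + emean T (g P)).

Let bad P : set (cube R d) :=
  [set T | 4%:E * emean P (g P) < emean T (g P)] `|`
  [set T | 4%:E * emean P (u P) < emean T (u P)].

Let w P : \bar R := emean P (g P) + (c P)%:E * emean P (u P).

Let eg0 P T : 0 <= emean T (g P). Proof. exact: emean_ge0. Qed.
Let eu0 P T : 0 <= emean T (u P). Proof. exact: emean_ge0. Qed.

Let cu0 P (t : \bar R) : 0 <= t -> 0 <= (c P)%:E * t.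
Proof. by move=> t0; rewrite mule_ge0// lee_fin ltW. Qed.

Let w0 P : 0 <= w P.
Proof. by apply: adde_ge0 => //; exact: cu0. Qed.

(** Each of the two selection conditions costs at most a quarter of [P]; this is the reason for the
    factor 4. *)
Let bad_small P : mu (hit (bad P) P) <= (2^-1)%:E * mu (hcube P).
Proof.
have -> : hit (bad P) P =
    hit [set T | 4%:E * emean P (g P) < emean T (g P)] P `|`
    hit [set T | 4%:E * emean P (u P) < emean T (u P)] P.
  apply/seteqP; split=> x.
    by move=> [Px [n [b|b]]]; [left|right]; split=> //; exists n.
  by move=> [[Px [n b]]|[Px [n b]]]; split=> //; exists n; [left|right].
apply: le_trans (measureU2 _ _ _) _; try exact: measurable_hit.
apply: (@le_trans _ _ ((4^-1)%:E * mu (hcube P) + (4^-1)%:E * mu (hcube P))).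
  by apply: leeD; exact: weak_type.
rewrite -ge0_muleDl ?lee_fin ?invr_ge0// -EFinD.
by rewrite (_ : (4^-1 + 4^-1)%R = (2^-1)%R :> R)//; lra.
Qed.

(** A bad cube becomes its own ancestor, and no cube is bad for itself since [4 t < t] is
    impossible. For the parent of a newly selected cube, this bounds the means over that parent. *)
Let anc_notbad x n : ~ bad (anc Q bad x n) (iter n (sub x) Q).
Proof.
have irr P : ~ bad P P.
  have le4 (t : \bar R) : 0 <= t -> ~ (4%:E * t < t).
    move=> t0; apply/negP; rewrite -leNgt -[leLHS]mul1e; apply: lee_wpmul2r => //.
    by rewrite lee_fin; lra.
  by case; exact: le4.
by case: n => [|n] //=; case: asboolP.
Qed.

Let anc_iter x n : exists2 k, (k <= n)%N & anc Q bad x n = iter k (sub x) Q.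
Proof.
elim: n => [|n [k kn IH]]; first by exists 0%N.
rewrite /=; case: ifP => _; first by exists n.+1.
by exists k => //; exact: leqW.
Qed.

Fixpoint ancestors x n : seq (cube R d) :=
  if n is m.+1 then
    if `[< bad (anc Q bad x m) (iter n (sub x) Q) >]
    then anc Q bad x m :: ancestors x m else ancestors x m
  else [::].

Let ancestorsP x n : hcube Q x -> uniq (anc Q bad x n :: ancestors x n) /\
  forall P, P \in anc Q bad x n :: ancestors x n ->
    [/\ stopping Q bad P, hcube P x & exists2 k, (k <= n)%N & P = iter k (sub x) Q].
Proof.
move=> Qx; elim: n => [|n [un IH]].
  split=> // P; rewrite /= mem_seq1 => /eqP ->; split=> //.
    exact: stopping_top.
  by exists 0%N.
have up P : P \in anc Q bad x n :: ancestors x n ->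
    [/\ stopping Q bad P, hcube P x & exists2 k, (k <= n.+1)%N & P = iter k (sub x) Q].
  by move=> /IH[? ? [k kn Pk]]; split=> //; exists k => //; exact: leqW.
have := anc_stopping bad n.+1 Qx.
rewrite [anc _ _ _ _]/= [ancestors _ _]/= -!iterS; case: ifPn => _ SP //.
split.
  rewrite cons_uniq un andbT; apply/negP => /IH[_ _ [k kn /iter_sub_inj]].
  by move=> nk; rewrite -nk ltnn in kn.
move=> P; rewrite in_cons => /predU1P[->|]; last exact: up.
by split=> //; [exact: hcube_iter|exists n.+1].
Qed.

(** The 4 comes from a parent that is not bad, the [2 ^+ d] from passing to its half. *)
Let K : R := (4 * 2 ^+ d)%R.
Let C : R := (2 * A * K)%R.
Let Phi P x := g P x + (2 * A * c P)%:E * u P x.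

Let K4 : (4 <= K)%R.
Proof. by rewrite /K ler_peMr// exprn_ege1// ler1n. Qed.

Let K1 : (1 <= K)%R.
Proof. by apply: le_trans K4; rewrite ler1n. Qed.

Let A0 : (0 < A)%R. Proof. exact: lt_le_trans A1. Qed.

Let C0 : (0 < C)%R.
Proof.
have K0 : (0 < K)%R by apply: lt_le_trans K1.
by rewrite /C !mulr_gt0.
Qed.

Let Phi_step x n : hcube Q x -> bad (anc Q bad x n) (iter n.+1 (sub x) Q) ->
  Phi (anc Q bad x n) x <= Phi (iter n.+1 (sub x) Q) x +
    C%:E * (w (anc Q bad x n) + w (iter n.+1 (sub x) Q)).
Proof.
move=> Qx b; have [k kn Pk] := anc_iter x n.
set P := anc Q bad x n in b Pk *; set T := iter n.+1 (sub x) Q in b *.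
have TP : T = iter (n - k).+1 (sub x) P.
  by rewrite Pk -iterD -subSn// subnK// leqW.
have Px : hcube P x by rewrite Pk; exact: hcube_iter.
have parent h : measurable_fun setT h -> (forall y, 0 <= h y) ->
    emean (iter n (sub x) Q) h <= 4%:E * emean P h -> emean T h <= K%:E * emean P h.
  move=> mh h0 Ph; rewrite /T iterS; apply: le_trans (emean_half _ _ mh h0) _.
  rewrite /K mulrC EFinM -muleA lee_wpmul2l// lee_fin exprn_ge0//.
have [ng nu] : emean (iter n (sub x) Q) (g P) <= 4%:E * emean P (g P) /\
    emean (iter n (sub x) Q) (u P) <= 4%:E * emean P (u P).
  have := @anc_notbad x n; rewrite -/P => /not_orP[n1 n2].
  by split; rewrite leNgt; [exact/negP|exact/negP].
apply: (@potential_step R _ _ _ _ _ _ _ _ A K s) => //.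
- exact: c_iter TP.
- have : u P x <= u T x + emean T (u T) + emean T (u P) by exact: u_iter TP.
  by move=> /le_trans; apply; apply: leeD => //; exact: parent.
- have : g P x <= g T x + A%:E *
      ((s * c T)%:E * (u T x + emean T (u T)) + emean T (g P)).
    exact: g_iter TP.
  move=> /le_trans; apply; apply: leeD => //; apply: lee_wpmul2l.
    by rewrite lee_fin ltW.
  by apply: leeD => //; exact: parent.
Qed.

Let sum_cons P r : \sum_(T <- P :: r) w T = w P + \sum_(T <- r) w T.
Proof. by rewrite big_cons. Qed.

(** Each selected cube passed takes part in at most two steps, once as the smaller and once as the
    larger cube, hence the two sums of [w]. *)
Let Phi_sum x n : hcube Q x -> Phi Q x <= Phi (anc Q bad x n) x +
  C%:E * (\sum_(P <- anc Q bad x n :: ancestors x n) w P +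
          \sum_(P <- ancestors x n) w P).
Proof.
have s0' (r : seq (cube R d)) : 0 <= \sum_(P <- r) w P by exact: sume_ge0.
move=> Qx; elim: n => [|n IH].
  rewrite leeDl//; apply: mule_ge0; [by rewrite lee_fin ltW|exact: adde_ge0].
rewrite [anc _ _ _ _]/= [ancestors _ _]/= -!iterS; case: ifPn => // /asboolP b.
apply: le_trans IH _; apply: le_trans (leeD (Phi_step Qx b) (lexx _)) _.
rewrite -addeA leeD2l//.
rewrite -(ge0_muleDr _ (adde_ge0 (w0 _) (w0 _)) (adde_ge0 (s0' _) (s0' _))) !sum_cons.
apply: lee_wpmul2l; first by rewrite lee_fin ltW.
move: (w (anc _ _ _ _)) (w (iter _ _ _)) (\sum_(_ <- _) _) => a a' t.
rewrite -!addeA. by rewrite (addeCA a a') (addeCA t a).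
Qed.

Lemma le_esum_seq (S : set (cube R d)) (f : cube R d -> \bar R) r : uniq r ->
  (forall P, P \in r -> S P) -> \sum_(P <- r) f P <= \esum_(P in S) f P.
Proof.
move=> ur rS; apply: esum_ge; exists [set` r]; last by rewrite -fsbig_seq.
by split; [exact: finite_seq|move=> P /rS].
Qed.

(** At the last selected cube the two pointwise bounds give [Phi P x <= C * w P]. Together with
    [Phi_sum], every [w] then occurs twice, hence [2 * C]. *)
Let pointwise x n P : hcube Q x -> P = anc Q bad x n ->
  g P x <= 4%:E * emean P (g P) -> u P x <= 4%:E * emean P (u P) ->
  g Q x <= (2 * C)%:E *
    \esum_(P in stopping Q bad) (w P * (\1_(cube_set P) x)%:E).
Proof.
move=> Qx PE gP uP; set W := \esum_(_ in _) _.
have s0' (r : seq (cube R d)) : 0 <= \sum_(P <- r) w P by exact: sume_ge0.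
have [un mem] := ancestorsP n Qx.
have sW : \sum_(P <- anc Q bad x n :: ancestors x n) w P <= W.
  rewrite big_seq (eq_bigr (fun P => w P * (\1_(cube_set P) x)%:E)).
    rewrite -big_seq; apply: le_esum_seq => // T /mem[].
    by [].
  move=> T /mem[_ /hcube_sub_cube Tx _].
  by rewrite indicE mem_set// mule1.
have PhiP : Phi P x <= C%:E * w P.
  have c8 : 0 <= (2 * A * c P)%:E by rewrite lee_fin !mulr_ge0// ltW.
  apply: le_trans (leeD gP (lee_wpmul2l c8 uP)) _.
  have C4 : (4 <= C)%R.
    by rewrite /C -[leLHS]mul1r ler_pM// mulr_ege1// ler1n.
  rewrite /w (ge0_muleDr _ (eg0 _ _) (cu0 _ (eu0 _ _))); apply: leeD.
    by apply: lee_wpmul2r.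
  move: (emean P (u P)) (eu0 P P) => e e0.
  rewrite !muleA -!EFinM; apply: lee_wpmul2r => //; rewrite lee_fin /C mulrAC.
  by apply: ler_wpM2r; [exact: ltW|rewrite ler_wpM2l// mulr_ge0// ltW].
have gPhi : g Q x <= Phi Q x.
  by rewrite leeDl// mule_ge0// lee_fin !mulr_ge0// ltW.
apply: le_trans gPhi _; apply: le_trans (Phi_sum n Qx) _.
rewrite -PE; apply: le_trans (leeD PhiP (lexx _)) _.
rewrite -PE sum_cons in sW.
rewrite -(ge0_muleDr _ (w0 _) (adde_ge0 (s0' _) (s0' _))).
have -> : (2 * C)%:E * W = C%:E * (2%:E * W) by rewrite muleA -EFinM (mulrC C).
rewrite sum_cons.
apply: lee_wpmul2l; first by rewrite lee_fin ltW.
have -> : 2%:E * W = W + W.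
  by rewrite (_ : 2%:E = 1 + 1 :> \bar R) ?ge0_muleDl ?mul1e// -EFinD.
apply: le_trans (leeD sW sW).
move: (w P) (\sum_(_ <- _) _) => a t.
by rewrite -!addeA (addeCA t a).
Qed.

Lemma sparse_domination : exists S : set (cube R d),
  [/\ S `<=` dyadic Q, sparse S & {ae mu, forall x, cube_set Q x ->
    g Q x <= (2 * (2 * A * (4 * 2 ^+ d)))%:E *
      \esum_(P in S) (emean P (g P) + (c P)%:E * emean P (u P)) *
        (\1_(cube_set P) x)%:E}].
Proof.
exists (stopping Q bad); split; first exact: stopping_dyadic.
  exact: sparse_stopping.
(* Points where [h] exceeds four times its mean over [P] although no dyadic mean around them does.
   They form a null set by differentiation, and the empty set if the mean is infinite. *)
pose N h P := [set x | hcube P x /\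
  (forall n, emean (iter n (sub x) P) h <= 4%:E * emean P h) /\
  4%:E * emean P h < h x].
have N0 h P : measurable_fun setT h -> (forall x, 0 <= h x) ->
    mu.-negligible (N h P).
  move=> mh h0; rewrite /N; have := emean_ge0 P h0.
  case: (emean P h) => [a| |] //= a0.
    rewrite -EFinM; apply: negligible_gt_dyadic_means => //.
    by rewrite mulr_ge0.
  rewrite gt0_muley ?lte_fin//; apply: negligibleS (negligible_set0 _).
  by move=> x [_ [_]]; rewrite ltNge leey.
(* The exceptional points: the upper faces of [Q], the points without a last selected cube, and the
   sets [N] for the countably many dyadic cubes. *)
apply: (@negligibleS _ _ _ _ ((cube_set Q `\` hcube Q) `|`
   ([set x | hcube Q x /\ forall P, stopping Q bad P -> ~ last_piece bad P x] `|`
   \bigcup_k (N (g (dyadic_enum Q k)) (dyadic_enum Q k) `|`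
              N (u (dyadic_enum Q k)) (dyadic_enum Q k))))); last first.
  apply: negligibleU; first exact: negligible_cubeD.
  apply: negligibleU; first exact: negligible_no_last_piece.
  by apply: negligible_bigcup => k; apply: negligibleU; exact: N0.
move=> x /= /not_implyP[Qx ngx].
have [hQx|] := pselect (hcube Q x); last by left.
right; have [[P SP Px]|nP] := pselect (exists2 P, stopping Q bad P & last_piece bad P x);
  last by left; split=> // P SP Px; apply: nP; exists P.
right; have [k Pk] := dyadic_enumP (stopping_dyadic SP); exists k => //; rewrite -Pk.
have [Px' nbad] := Px.
have le4 n : ~ bad P (iter n (sub x) P) by move=> b; apply: nbad; split=> //; exists n.
have [gP|gP] := leP (g P x) (4%:E * emean P (g P)); last first.
  left; split=> //; split=> // n; rewrite leNgt; apply/negP => lt.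
  by apply: (le4 n); left.
have [uP|uP] := leP (u P x) (4%:E * emean P (u P)); last first.
  right; split=> //; split=> // n; rewrite leNgt; apply/negP => lt.
  by apply: (le4 n); right.
have [n Pn] := last_pieceP SP Px.
by exfalso; apply: ngx; apply: (@pointwise x n P) => //; rewrite -(Pn 0%N).
Qed.

End sparse_domination.

(** * Inequalities for real powers *)

Section powers.
Context {R : realType}.
Implicit Types (a b q r s : R).

(** Young's inequality for [2^-s] and [1] with exponents [1/s] and [1/(1-s)] gives [s/2 + (1-s)]. *)
Lemma powR2N_le s : 0 < s < 1 -> 2 `^ (- s) <= 1 - s / 2.
Proof.
move=> /andP[s0 s1].
have h : 0 < 1 - s by rewrite subr_gt0.
have : (2 `^ (- s)) * 1 <= (2 `^ (- s)) `^ s^-1 / s^-1 + 1 `^ (1 - s)^-1 / (1 - s)^-1.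
  by apply: conjugate_powR; rewrite ?powR_ge0 ?invr_gt0// !invrK; ring.
rewrite mulr1 -powRrM mulNr divff ?gt_eqF// powR_inv1// powR1 !invrK mul1r.
by move=> /le_trans; apply; lra.
Qed.

Lemma powRD_le a b r : 0 <= a -> 0 <= b -> 0 <= r ->
  (a + b) `^ r <= 2 `^ r * (a `^ r + b `^ r).
Proof.
wlog ab : a b / a <= b => [hw|] a0 b0 r0.
  have [ab|/ltW ba] := leP a b; first exact: hw.
  by rewrite addrC [X in _ * X]addrC; exact: hw.
apply: (@le_trans _ _ ((2 * b) `^ r)).
  by apply: ge0_ler_powR; rewrite ?nnegrE ?addr_ge0 ?mulr_ge0//; lra.
by rewrite powRM// ler_wpM2l ?powR_ge0// lerDr powR_ge0.
Qed.

(** For [t = a] and [t = b], the ratio [t / (a + b)] is in [[0, 1]] and so at most its [q]-th power;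
    add the two. *)
Lemma powR_subadditive a b q : 0 <= a -> 0 <= b -> 0 < q <= 1 ->
  (a + b) `^ q <= a `^ q + b `^ q.
Proof.
move=> a0 b0 /andP[q0 q1].
have := addr_ge0 a0 b0; rewrite le_eqVlt => /predU1P[<-|ab0].
  by rewrite powR0 ?gt_eqF// addr_ge0// powR_ge0.
have ge t : 0 <= t -> t <= a + b -> t / (a + b) * (a + b) `^ q <= t `^ q.
  move=> t0 tab; have := t0; rewrite le_eqVlt => /predU1P[<-|t0'].
    by rewrite !mul0r powR_ge0.
  have e : t = t / (a + b) * (a + b) by rewrite divfK// gt_eqF.
  have abw := ltW ab0.
  rewrite [in X in _ <= X]e powRM ?divr_ge0//.
  rewrite ler_wpM2r ?powR_ge0//; apply: ger1_powR => //.
  by rewrite divr_gt0//= ler_pdivrMr// mul1r.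
apply: le_trans (lerD (ge a a0 _) (ge b b0 _)); [|lra|lra].
by rewrite -mulrDl -mulrDl divff ?mul1r// gt_eqF.
Qed.

Lemma poweR_subadditive (x y : \bar R) q : (0 <= x)%E -> (0 <= y)%E ->
  0 < q <= 1 -> ((x + y) `^ q <= x `^ q + y `^ q)%E.
Proof.
move=> + + /andP[q0 q1]; case: x => [a| |] //; case: y => [b| |] // a0 b0.
- by rewrite -EFinD !poweR_EFin -EFinD lee_fin powR_subadditive// q0.
- by rewrite [(_ + +oo)%E]/= !poweRyr ?gt_eqF// ge0_addey ?poweR_ge0.
- by rewrite [(+oo + _)%E]/= !poweRyr ?gt_eqF// ge0_addye ?poweR_ge0.
- by rewrite [(+oo + _)%E]/= !poweRyr ?gt_eqF// ge0_addye ?poweR_ge0.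
Qed.

End powers.

(** * Distances and tripled cubes *)

Section distances.
Context {R : realType} {d : nat}.
Implicit Types (P T : cube R d) (x y z : Rn R d).

Lemma edist_ge0 x y : 0 <= edist x y.
Proof. exact: sqrtr_ge0. Qed.

Lemma edist_ge_coord x y i : `|coord x i - coord y i| <= edist x y.
Proof.
rewrite /edist -sqrtr_sqr ler_sqrt ?sumr_ge0//; last by move=> j _; exact: sqr_ge0.
rewrite (bigD1 i)//= lerDl sumr_ge0// => j _; exact: sqr_ge0.
Qed.

Lemma coord_triple P i :
  coord (corner (triple P)) i = coord (corner P) i - (side P)%:num.
Proof. by rewrite /coord tnth_mktuple. Qed.

Lemma edist_notin_triple T x y : hcube T x -> ~ cube_set (triple T) y ->
  (side T)%:num <= edist x y.
Proof.
move=> Tx /existsNP[i /negP]; rewrite coord_triple /= => yi.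
apply: le_trans (edist_ge_coord x y i); have /andP[x1 x2] := Tx i.
move: yi; rewrite negb_and -!ltNge => /orP[yi|yi].
  by apply: le_trans (ler_norm _); lra.
by rewrite distrC; apply: le_trans (ler_norm _); lra.
Qed.

(** In each coordinate [z] and [x] differ by at most [l(T) <= |x - y|], so [(z_i - y_i)^2 <= 2 |x -
    y|^2 + 2 (x_i - y_i)^2]. The sum is [(2 d + 2) |x - y|^2], and [2 d + 2] is at most its
    square. *)
Lemma edist_comparable T x y z : hcube T x -> hcube T z ->
  ~ cube_set (triple T) y -> edist z y <= (2 * d%:R + 2) * edist x y.
Proof.
move=> Tx Tz Ty; have xy := edist_notin_triple Tx Ty.
have e0 := edist_ge0 x y; have l0 := side_gt0 T.
have d0 : 0 <= d%:R :> R by [].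
have sq : edist x y ^+ 2 = \sum_(i < d) (coord x i - coord y i) ^+ 2.
  by rewrite sqr_sqrtr// sumr_ge0// => i _; exact: sqr_ge0.
rewrite -(ler_pXn2r (n := 2))// ?nnegrE ?mulr_ge0 ?edist_ge0 ?addr_ge0//.
rewrite {1}/edist sqr_sqrtr; last by apply: sumr_ge0 => i _; exact: sqr_ge0.
apply: (@le_trans _ _ (\sum_(i < d) (2 * edist x y ^+ 2 +
    2 * (coord x i - coord y i) ^+ 2))).
  apply: ler_sum => i _; have /andP[x1 x2] := Tx i; have /andP[z1 z2] := Tz i.
  have h : (coord z i - coord x i) ^+ 2 <= edist x y ^+ 2.
    rewrite -real_normK ?num_real// ler_pXn2r ?nnegrE//.
    by apply: le_trans xy; rewrite ler_norml; lra.
  have := sqr_ge0 ((coord z i - coord x i) - (coord x i - coord y i)).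
  rewrite !expr2 in h *; lra.
rewrite big_split/= -!mulr_sumr -sq sumr_const card_ord -[_ *+ d]mulr_natr exprMn.
rewrite !expr2; move: (edist x y) (d%:R : R) e0 d0 => t D t0 D0.
have h0 := mulr_ge0 t0 t0; have h1 := mulr_ge0 h0 D0; have h2 := mulr_ge0 h1 D0.
lra.
Qed.

Lemma triple_half P (b : 'I_d -> bool) :
  cube_set (triple (half P b)) `<=` cube_set (triple P).
Proof.
move=> y Py i; have := Py i; rewrite !coord_triple coord_half /=.
have := side_gt0 P.
by case: ifPn => _ ? /andP[? ?]; apply/andP; split; lra.
Qed.

Lemma triple_iter x P n :
  cube_set (triple (iter n (sub x) P)) `<=` cube_set (triple P).
Proof. by elim: n => //= n IH; apply: subset_trans IH; exact: triple_half. Qed.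

End distances.

(** * Measurability of the kernel and of [frac_grad] *)

Section measurability.
Context {R : realType} {d : nat}.
Implicit Types (P T : cube R d).

Lemma measurable_fun_sqrtr d' (X : measurableType d') (f : X -> R) :
  (forall x, 0 <= f x) -> measurable_fun setT f ->
  measurable_fun setT (fun x => Num.sqrt (f x)).
Proof.
move=> f0 mf; rewrite (_ : (fun _ => _) = (fun x => f x `^ 2^-1)).
  exact: measurableT_comp (@measurable_powR R _) mf.
by apply/funext => x; rewrite powR12_sqrt.
Qed.

Lemma measurable_edist :
  measurable_fun setT (fun p : Rn R d * Rn R d => edist p.1 p.2).
Proof.
apply: measurable_fun_sqrtr.
  by move=> p; apply: sumr_ge0 => i _; exact: sqr_ge0.
apply: measurable_sum => i; apply: measurable_funX; apply: measurable_funB.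
  exact: measurableT_comp (measurable_coord i) measurable_fst.
exact: measurableT_comp (measurable_coord i) measurable_snd.
Qed.

Lemma normcE (z w : R[i]) : normc (z - w) =
  Num.sqrt ((complex.Re z - complex.Re w) ^+ 2 + (complex.Im z - complex.Im w) ^+ 2).
Proof. by case: z => ? ?; case: w. Qed.

Lemma measurable_fun_normcB d' (X : measurableType d') (f g : X -> R[i]) :
  measurable_fun setT (fun x => complex.Re (f x)) ->
  measurable_fun setT (fun x => complex.Im (f x)) ->
  measurable_fun setT (fun x => complex.Re (g x)) ->
  measurable_fun setT (fun x => complex.Im (g x)) ->
  measurable_fun setT (fun x => normc (f x - g x)).
Proof.
move=> rf imf rg img; under eq_fun do rewrite normcE.
apply: measurable_fun_sqrtr; first by move=> x; rewrite addr_ge0 ?sqr_ge0.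
by apply: measurable_funD; apply: measurable_funX; exact: measurable_funB.
Qed.

Variable F : Rn R d -> R[i].
Hypotheses (mRe : measurable_fun setT (fun x => complex.Re (F x)))
  (mIm : measurable_fun setT (fun x => complex.Im (F x))).

Definition kernel (s r : R) x y : R :=
  normc (F x - F y) `^ r / edist x y `^ (d%:R + s * r).

Lemma kernel_ge0 s r x y : 0 <= kernel s r x y.
Proof. by rewrite divr_ge0 ?powR_ge0. Qed.

Lemma measurable_kernel s r :
  measurable_fun setT (fun p : Rn R d * Rn R d => kernel s r p.1 p.2).
Proof.
under eq_fun do rewrite /kernel -powRN.
apply: measurable_funM.
  apply: measurableT_comp (@measurable_powR R _) _; apply: measurable_fun_normcB.
  - exact: measurableT_comp mRe measurable_fst.
  - exact: measurableT_comp mIm measurable_fst.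
  - exact: measurableT_comp mRe measurable_snd.
  - exact: measurableT_comp mIm measurable_snd.
exact: measurableT_comp (@measurable_powR R _) measurable_edist.
Qed.

Lemma measurable_frac_grad s r P : measurable_fun setT (frac_grad s r P F).
Proof.
apply: measurableT_comp (@measurable_poweR R _) _.
pose f (p : Rn R d * Rn R d) := (kernel s r p.1 p.2 * \1_(cube_set P) p.2)%:E.
rewrite (_ : (fun _ => _) = fubini_F (lebesgue_Rn d) f); last first.
  apply/funext => x; rewrite /fubini_F [LHS]integral_mkcond; apply: eq_integral => y _.
  rewrite /f patchE /= indicE; case: ifPn => yP; first by rewrite mulr1.
  by rewrite mulr0.
apply: measurable_fun_fubini_tonelli_F.
  apply/measurable_EFinP; apply: measurable_funM; first exact: measurable_kernel.
  apply: measurableT_comp measurable_snd; apply: measurable_indic.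
  exact: measurable_cube_set.
by move=> p; rewrite lee_fin mulr_ge0// kernel_ge0.
Qed.

Lemma measurable_edist_pow p (x : Rn R d) :
  measurable_fun setT (fun y => (edist x y `^ p)%:E).
Proof.
apply/measurable_EFinP; apply: measurableT_comp (@measurable_powR R _) _.
exact: measurableT_comp measurable_edist (measurable_pair1 x).
Qed.

Lemma measurable_kernel1 s r x : measurable_fun setT (fun y => (kernel s r x y)%:E).
Proof.
apply/measurable_EFinP.
exact: measurableT_comp (measurable_kernel s r) (measurable_pair1 x).
Qed.

End measurability.

(** * The reflected extension is Borel on the whole space *)

Section fold_measurability.
Context {R : realType} {d : nat}.

Lemma measurable_floor : measurable_fun setT (fun t : R => (Num.floor t)%:~R : R).
Proof.
apply: (measurability _ (RGenOInfty.measurableE R)) => _ [_ [c ->] <-].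
rewrite setTI (_ : _ @^-1` _ = `[(Num.floor c + 1)%:~R, +oo[%classic) //.
apply/seteqP; split=> t /=; rewrite !in_itv/= !andbT.
  move=> ct; rewrite -floor_ge_int lezD1 -(ltr_int R).
  by apply: le_lt_trans ct; exact: ge_floor.
by rewrite -floor_ge_int => h; apply: lt_le_trans (floorD1_gt c) _; rewrite ler_int.
Qed.

Lemma fold_in (Q : cube R d) x : cube_set Q (fold Q x).
Proof.
move=> i; rewrite /fold [coord (mktuple _) i]tnth_mktuple.
set l := (side Q)%:num; set a := coord (corner Q) i; set t := coord x i - a.
have l0 : 0 < 2 * l by rewrite pmulr_rgt0 //; exact: side_gt0.
have h1 := ge_floor (t / (2 * l)).
have h2 := floorD1_gt (t / (2 * l)); rewrite intrD in h2.
set k : R := (Num.floor _)%:~R in h1 h2 *.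
rewrite ler_pdivlMr// in h1; rewrite ltr_pdivrMr// in h2.
have : `|t - 2 * l * k - l| <= l by rewrite ler_norml; apply/andP; split; lra.
have := normr_ge0 (t - 2 * l * k - l); move: `|_| => n ? ?.
by apply/andP; split; lra.
Qed.

Lemma measurable_fold (Q : cube R d) : measurable_fun setT (fold Q).
Proof.
apply/measurable_fun_tnthP => i; rewrite /comp /fold.
under eq_fun do rewrite tnth_mktuple.
have mt : measurable_fun setT (fun x : Rn R d => coord x i - coord (corner Q) i).
  by apply: measurable_funB => //; exact: measurable_coord.
apply: measurable_funB => //; apply: measurableT_comp => //; apply: measurable_funB => //.
apply: measurable_funB => //; apply: measurable_funM => //.
apply: measurableT_comp measurable_floor _; exact: measurable_funM.
Qed.

(** Integrability gives measurability of [f] on [Q], and [fold Q] takes all its values there. *)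
Lemma measurable_reflect_ext (Q : cube R d) (f : Rn R d -> R[i]) : L1 Q f ->
  measurable_fun setT (fun x => complex.Re (reflect_ext Q f x)) /\
  measurable_fun setT (fun x => complex.Im (reflect_ext Q f x)).
Proof.
have sub : fold Q @` setT `<=` cube_set Q by move=> _ [x _ <-]; exact: fold_in.
move=> [/measurable_int/measurable_EFinP mRe /measurable_int/measurable_EFinP mIm].
split; [apply: (measurable_comp _ _ mRe) => //|apply: (measurable_comp _ _ mIm) => //].
- exact: measurable_cube_set.
- exact: measurable_fold.
- exact: measurable_cube_set.
- exact: measurable_fold.
Qed.

End fold_measurability.

(** * Averaging an inequality over a cube *)

Section average_inequality.
Context {R : realType} {d : nat}.
Implicit Types (P T : cube R d) (g h : Rn R d -> \bar R).
Local Notation mu := (lebesgue_Rn d : {measure set (Rn R d) -> \bar R}).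

(** Integrate over [z] in [T] and divide by the volume. A bound that passes through an arbitrary
    intermediate point [z] thus becomes a bound by means. *)
Lemma le_emean_comb T (a b : \bar R) (k l : R) g h :
  measurable_fun setT g -> (forall x, (0 <= g x)%E) ->
  measurable_fun setT h -> (forall x, (0 <= h x)%E) ->
  (0 <= a)%E -> (0 <= b)%E -> 0 <= k -> 0 <= l ->
  (forall z, hcube T z -> (a <= b + k%:E * g z + l%:E * h z)%E) ->
  (a <= b + k%:E * emean T g + l%:E * emean T h)%E.
Proof.
move=> mg g0 mh h0 a0 b0 k0 l0 le_a.
have mT := measurable_hcube T.
have v0 := vol_gt0 T.
have kg0 z : (0 <= k%:E * g z)%E by rewrite mule_ge0.
have lh0 z : (0 <= l%:E * h z)%E by rewrite mule_ge0.
have kI : (0 <= k%:E * emean T g)%E by rewrite mule_ge0// emean_ge0.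
have lI : (0 <= l%:E * emean T h)%E by rewrite mule_ge0// emean_ge0.
have mkg : measurable_fun (hcube T) (fun z => k%:E * g z)%E.
  by apply: measurable_funeM; exact: measurable_funS mg.
have mlh : measurable_fun (hcube T) (fun z => l%:E * h z)%E.
  by apply: measurable_funeM; exact: measurable_funS mh.
have mbg : measurable_fun (hcube T) (fun z => b + k%:E * g z)%E.
  by apply: emeasurable_funD.
suff : (a * (vol T)%:E <=
        (b + k%:E * emean T g + l%:E * emean T h) * (vol T)%:E)%E.
  by rewrite lee_pmul2r// lte_fin.
have int_scale c f : measurable_fun setT f -> (forall x, (0 <= f x)%E) -> 0 <= c ->
    (c%:E * emean T f * (vol T)%:E = \int[mu]_(z in hcube T) (c%:E * f z))%E.
  move=> mf f0 c0; rewrite ge0_integralZl_EFin//; last exact: measurable_funS mf.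
  by rewrite integral_hcube//; apply/esym; exact: muleA.
have int_const (c : \bar R) : (c * (vol T)%:E = \int[mu]_(z in hcube T) c)%E.
  by rewrite integral_cst// [X in (_ = _ * X)%E]lebesgue_hcube.
rewrite !ge0_muleDl ?adde_ge0// !int_scale// !int_const.
rewrite -!ge0_integralD//; last by move=> z _; rewrite adde_ge0.
apply: ge0_le_integral => //.
by apply: emeasurable_funD.
Qed.

End average_inequality.

(** * The integral of [|x - y|^-(d + s r)] over [3P] minus [3T] *)

Section far_field.
Context {R : realType} {d : nat}.
Implicit Types (P T : cube R d) (x y z : Rn R d).
Local Notation mu := (lebesgue_Rn d : {measure set (Rn R d) -> \bar R}).
Variables (s r : R).
Hypotheses (s01 : 0 < s < 1) (r1 : 1 <= r).

Lemma powR2N_prod_le : 2 `^ (- (s * r)) <= 1 - s / 2.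
Proof.
have /andP[s0 s1] := s01.
apply: le_trans (powR2N_le s01); apply: ler_powR; first by rewrite ler1n.
by rewrite lerN2 ler_peMr// ltW.
Qed.

(** Cut the region into layers between the triples of consecutive generations. Outside [3T] the
    distance to [x] is at least [l(T)], and the triple of the parent has volume [(6 l(T))^d], so one
    layer contributes at most [6^d l(T)^(-s r)]. The difference on the right telescopes over the
    layers. *)
Lemma le_tail_integral x P T n : hcube P x -> T = iter n (sub x) P ->
  (\int[mu]_(y in cube_set (triple P) `\` cube_set (triple T))
     ((edist x y `^ (d%:R + s * r))^-1)%:E <=
   (6 ^+ d * (2 / s) *
     ((side T)%:num `^ (- (s * r)) - (side P)%:num `^ (- (s * r))))%:E)%E.
Proof.
have /andP[s0 s1] := s01; have r0 : 0 < r by exact: lt_le_trans r1.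
have sr0 : 0 < s * r by rewrite mulr_gt0.
move=> Px; elim: n T => [|n IH] _ ->.
  by rewrite setDv integral_set0 subrr mulr0.
have {}IH := IH _ erefl.
set T' := iter n (sub x) P in IH; rewrite iterS -/T'; set T := sub x T'.
set p := d%:R + s * r in IH *.
have p0 : 0 < p by rewrite ltr_wpDl.
have mD A B : measurable (cube_set (triple A) `\` cube_set (triple B) : set (Rn R d)).
  by apply: measurableD; exact: measurable_cube_set.
have mk : measurable_fun [set: Rn R d] (fun y => ((edist x y `^ p)^-1)%:E).
  by under eq_fun do rewrite -powRN; exact: measurable_edist_pow.
have k0 y : (0 <= ((edist x y `^ p)^-1)%:E)%E by rewrite lee_fin invr_ge0 powR_ge0.
have TT' : cube_set (triple T) `<=` cube_set (triple T') by exact: triple_half.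
have T'P : cube_set (triple T') `<=` cube_set (triple P) by exact: triple_iter.
have -> : cube_set (triple P) `\` cube_set (triple T) =
    (cube_set (triple P) `\` cube_set (triple T')) `|`
    (cube_set (triple T') `\` cube_set (triple T)).
  apply/seteqP; split=> y.
    by move=> [Py Ty]; have [T'y|T'y] := pselect (cube_set (triple T') y); [right|left].
  by move=> [[Py T'y]|[/T'P Py Ty]]; split=> // /TT'.
rewrite ge0_integral_setU//; last 2 first.
- exact: measurable_funS mk.
- apply/disj_setPS => y [[_ ?] [? _]]//.
apply: le_trans (leeD IH (_ : _ <= (6 ^+ d * (side T)%:num `^ (- (s * r)))%:E)%E) _.
  set l := (side T)%:num; have l0 : 0 < l by exact: side_gt0.
  apply: (@le_trans _ _ (\int[mu]_(y in cube_set (triple T') `\` cube_set (triple T))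
      ((l `^ p)^-1)%:E)%E).
    apply: ge0_le_integral => //; first exact: measurable_funS mk.
    move=> y [_ Ty]; rewrite lee_fin lef_pV2 ?posrE ?powR_gt0//.
    + apply: ge0_ler_powR; rewrite ?nnegrE ?edist_ge0 ?(ltW l0) ?(ltW p0)//.
      by apply: edist_notin_triple Ty; apply: hcube_sub; exact: hcube_iter.
    + apply: lt_le_trans l0 _; apply: edist_notin_triple Ty.
      by apply: hcube_sub; exact: hcube_iter.
  rewrite integral_cst//.
  apply: (@le_trans _ _ (((l `^ p)^-1)%:E * mu (cube_set (triple T')))%E).
    apply: lee_wpmul2l; first by rewrite lee_fin invr_ge0 powR_ge0.
    apply: le_measure; rewrite ?inE//; exact: measurable_cube_set.
  rewrite [X in (_ * X)%E](volumeE (triple T')) -EFinM lee_fin.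
  have -> : (side (triple T'))%:num = 6 * l :> R.
    by rewrite /l /=; field.
  rewrite exprMn mulrCA ler_wpM2l ?exprn_ge0// -powR_mulrn; last exact: ltW.
  have -> // : l `^ (- (s * r)) = (l `^ p)^-1 * l `^ d%:R.
  rewrite -powRN -[RHS]powRD; last by rewrite (gt_eqF l0) implybT.
  by congr (_ `^ _); rewrite /p; ring.
have -> : (side T')%:num = 2 * (side T)%:num :> R by rewrite /=; field.
rewrite -EFinD lee_fin powRM//.
have := powR_ge0 (side T)%:num (- (s * r)).
move: ((side P)%:num `^ _) ((side T)%:num `^ _) => u v v0.
(* This is [1 - 2^(-s r) >= s / 2]: the growth of [l^(-s r)] over one generation, times [2 / s],
   pays for one layer. *)
have h : 1 <= 2 / s * (1 - 2 `^ (- (s * r))).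
  rewrite -ler_pdivrMl ?divr_gt0// mulr1 invf_div.
  by have := powR2N_prod_le; lra.
have := ler_wpM2l (mulr_ge0 (exprn_ge0 d (ler0n R 6)) v0) h.
move: (2 `^ _) (6 ^+ d) (2 / s) => x1 x2 x3; rewrite mulr1 => h'.
lra.
Qed.

End far_field.

(** * The part of [frac_grad] far from [T], seen from other points of [T] *)

Section far_field_difference.
Context {R : realType} {d : nat}.
Implicit Types (P T : cube R d) (x y z : Rn R d).
Local Notation mu := (lebesgue_Rn d : {measure set (Rn R d) -> \bar R}).
Variables (F : Rn R d -> R[i]) (s r : R).
Hypotheses (mRe : measurable_fun setT (fun x => complex.Re (F x)))
  (mIm : measurable_fun setT (fun x => complex.Im (F x))).
Hypotheses (s01 : 0 < s < 1) (r1 : 1 <= r).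

Let p := d%:R + s * r.
Let c : R := 2 * d%:R + 2.

Let s0 : 0 < s. Proof. by case/andP: s01. Qed.
Let r0 : 0 < r. Proof. exact: lt_le_trans r1. Qed.
Let p0 : 0 < p. Proof. by rewrite ltr_wpDl// mulr_gt0. Qed.
Let c1 : 1 <= c.
Proof. by rewrite /c; have : 0 <= d%:R :> R by []; lra. Qed.
Let c0 : 0 < c. Proof. exact: lt_le_trans c1. Qed.

Lemma normcB_triangle (a b e : R[i]) :
  normc (a - b) <= normc (a - e) + normc (e - b).
Proof. by rewrite (_ : a - b = (a - e) + (e - b)) ?le_normcD// addrA subrK. Qed.

(** Split [F x - F y] at [F z] with [(a + b)^r <= 2^r (a^r + b^r)]. In the term with [F z - F y],
    the distance from [x] is replaced by the one from [z] at the cost of [c^p]. *)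
Lemma kernel_far x y z T : hcube T x -> hcube T z ->
  ~ cube_set (triple T) y ->
  kernel F s r x y <= 2 `^ r * normc (F x - F z) `^ r * (edist x y `^ p)^-1 +
                      2 `^ r * c `^ p * kernel F s r z y.
Proof.
move=> Tx Tz Ty.
have l0 := side_gt0 T; have xy := edist_notin_triple Tx Ty.
have zy := edist_notin_triple Tz Ty.
have exy : 0 < edist x y by exact: lt_le_trans xy.
have ezy : 0 < edist z y by exact: lt_le_trans zy.
have inv_le : (edist x y `^ p)^-1 <= c `^ p * (edist z y `^ p)^-1.
  rewrite -ler_pdivrMl ?powR_gt0// -invfM lef_pV2 ?posrE ?mulr_gt0 ?powR_gt0//.
  rewrite -powRM ?(ltW c0) ?(ltW exy)//.
  apply: ge0_ler_powR; rewrite ?nnegrE ?mulr_ge0 ?(ltW p0) ?(ltW c0)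
    ?(ltW exy) ?(ltW ezy)//.
  exact: edist_comparable Tx Tz Ty.
have num_le : normc (F x - F y) `^ r <=
    2 `^ r * (normc (F x - F z) `^ r + normc (F z - F y) `^ r).
  apply: le_trans (powRD_le _ _ (ltW r0)); rewrite ?normcE ?sqrtr_ge0//.
  apply: ge0_ler_powR; rewrite ?nnegrE ?addr_ge0 ?(ltW r0) ?normcE ?sqrtr_ge0//.
  by rewrite -!normcE normcB_triangle.
apply: le_trans (ler_wpM2r _ num_le) _; first by rewrite invr_ge0 powR_ge0.
rewrite mulrDr mulrDl lerD2l -!mulrA ler_wpM2l ?powR_ge0//.
by rewrite mulrCA ler_wpM2l ?powR_ge0.
Qed.

Let D P T := cube_set (triple P) `\` cube_set (triple T) : set (Rn R d).

Let mD P T : measurable (D P T).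
Proof. by apply: measurableD; exact: measurable_cube_set. Qed.

Let mk x : measurable_fun [set: Rn R d] (fun y => ((edist x y `^ p)^-1)%:E).
Proof. by under eq_fun do rewrite -powRN; exact: measurable_edist_pow. Qed.

Let k0 x y : (0 <= ((edist x y `^ p)^-1)%:E)%E.
Proof. by rewrite lee_fin invr_ge0 powR_ge0. Qed.

Lemma frac_gradE P x : frac_grad s r P F x =
  ((\int[mu]_(y in cube_set P) (kernel F s r x y)%:E) `^ r^-1)%E.
Proof. by []. Qed.

Lemma int_kernel_ge0 x A : (0 <= \int[mu]_(y in A) (kernel F s r x y)%:E)%E.
Proof. by apply: integral_ge0 => y _; rewrite lee_fin kernel_ge0. Qed.

(** Integrate [kernel_far] over [y] and take [r]-th roots term by term. The first term contains the
    tail integral; the second is at most the integral over all of [3P] seen from [z]. *)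
Lemma far_integral x z P T n : hcube P x -> T = iter n (sub x) P -> hcube T z ->
  ((\int[mu]_(y in D P T) (kernel F s r x y)%:E) `^ r^-1 <=
   (4 * 6 ^+ d * (s `^ (- r^-1) * (side T)%:num `^ (- s)) * normc (F x - F z))%:E +
   (2 * c ^+ d.+1)%:E * frac_grad s r (triple P) F z)%E.
Proof.
move=> Px Tn Tz; have Tx : hcube T x by rewrite Tn; exact: hcube_iter.
set l := (side T)%:num; have l0 : 0 < l by exact: side_gt0.
set N := normc (F x - F z); have N0 : 0 <= N by rewrite /N normcE sqrtr_ge0.
have q1 : 0 < r^-1 <= 1 by rewrite invr_gt0 r0 invf_le1.
have /andP[q0 q1'] := q1.
set J := 6 ^+ d * (2 / s) * l `^ (- (s * r)).
have sr0 : 0 < s * r by rewrite mulr_gt0.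
have J0 : 0 <= J by rewrite !mulr_ge0 ?exprn_ge0 ?powR_ge0 ?invr_ge0// ltW.
have tail : (\int[mu]_(y in D P T) ((edist x y `^ p)^-1)%:E <= J%:E)%E.
  apply: le_trans (le_tail_integral s01 r1 Px Tn) _; rewrite lee_fin /J.
  rewrite ler_wpM2l ?mulr_ge0 ?exprn_ge0 ?invr_ge0 ?(ltW s0)//.
  by rewrite gerBl powR_ge0.
have mkx w : measurable_fun (D P T) (fun y => (kernel F s r w y)%:E).
  by apply: measurable_funS (measurable_kernel1 mRe mIm s r w).
have near_far : (\int[mu]_(y in D P T) (kernel F s r z y)%:E <=
    \int[mu]_(y in cube_set (triple P)) (kernel F s r z y)%:E)%E.
  apply: ge0_subset_integral => //; first exact: measurable_cube_set.
  - exact: measurable_funS (measurable_kernel1 mRe mIm s r z).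
  - by move=> y _; rewrite lee_fin kernel_ge0.
  - by move=> y [].
have n1 : 0 <= 2 `^ r * N `^ r by rewrite mulr_ge0 ?powR_ge0.
have n2 : 0 <= 2 `^ r * c `^ p by rewrite mulr_ge0 ?powR_ge0.
have bound : (\int[mu]_(y in D P T) (kernel F s r x y)%:E <=
   (2 `^ r * N `^ r * J)%:E + (2 `^ r * c `^ p)%:E *
   \int[mu]_(y in cube_set (triple P)) (kernel F s r z y)%:E)%E.
  apply: (@le_trans _ _ (\int[mu]_(y in D P T)
      ((2 `^ r * N `^ r)%:E * ((edist x y `^ p)^-1)%:E +
       (2 `^ r * c `^ p)%:E * (kernel F s r z y)%:E))%E).
    apply: ge0_le_integral => //.
    - by move=> y _; rewrite lee_fin kernel_ge0.
    - apply: emeasurable_funD; apply: measurable_funeM => //.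
      exact: measurable_funS (mk x).
    - by move=> y [_ Ty]; rewrite -!EFinM -EFinD lee_fin; exact: kernel_far Tx Tz Ty.
  rewrite ge0_integralD//; last 4 first.
  - by move=> y _; rewrite mule_ge0.
  - by apply: measurable_funeM; exact: measurable_funS (mk x).
  - by move=> y _; rewrite mule_ge0// lee_fin kernel_ge0.
  - exact: measurable_funeM.
  rewrite !ge0_integralZl_EFin//; last 2 first.
  - by move=> y _; rewrite lee_fin kernel_ge0.
  - exact: measurable_funS (mk x).
  by apply: leeD; [rewrite [leRHS]EFinM|]; apply: lee_wpmul2l.
apply: le_trans (gt0_ler_poweR (ltW q0) _ _ bound) _.
- by rewrite in_itv/= leey andbT int_kernel_ge0.
- by rewrite in_itv/= leey andbT adde_ge0// ?mule_ge0 ?int_kernel_ge0// lee_fin mulr_ge0.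
apply: le_trans (poweR_subadditive _ _ q1) _.
- by rewrite lee_fin mulr_ge0.
- by rewrite mule_ge0 ?int_kernel_ge0.
have powK a : 0 <= a -> (a `^ r) `^ r^-1 = a.
  by move=> a0; rewrite -powRrM divff ?gt_eqF// powRr1.
apply: leeD.
  rewrite poweR_EFin lee_fin powRM// powRM ?powR_ge0// !powK//.
  have Jq : J `^ r^-1 <= 6 ^+ d * 2 * (s `^ (- r^-1) * l `^ (- s)).
    have -> : J = 6 ^+ d * 2 * (s `^ (-1) * l `^ (- (s * r))).
      by rewrite /J powR_inv1 ?(ltW s0)//; ring.
    rewrite powRM ?mulr_ge0 ?powR_ge0 ?exprn_ge0//.
    rewrite [(s `^ _ * _) `^ _]powRM ?powR_ge0// -!powRrM mulN1r mulNr mulfK ?gt_eqF//.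
    rewrite ler_wpM2r ?mulr_ge0 ?powR_ge0//; apply: ler1_powR => //.
    by rewrite mulr_ege1// ?exprn_ege1// ler1n.
  apply: le_trans (ler_wpM2l _ Jq) _; first by rewrite mulr_ge0.
  by rewrite le_eqVlt; apply/orP; left; apply/eqP; ring.
rewrite poweRM ?int_kernel_ge0// -frac_gradE; apply: lee_wpmul2r; first exact: poweR_ge0.
rewrite poweR_EFin lee_fin powRM ?powR_ge0// powK// ler_wpM2l//.
(* The exponent of [c >= 1] is [p / r = d / r + s], at most [d + 1]. *)
rewrite -powRrM -powR_mulrn ?(ltW c0)//; apply: ler_powR => //.
rewrite /p mulrDl -mulrA divff ?gt_eqF// mulr1 -natr1 lerD ?(ltW (proj2 (andP s01)))//.
by rewrite ler_piMr.
Qed.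

End far_field_difference.

(** * The step inequalities for [frac_grad] and the oscillation *)

Section discharge.
Context {R : realType} {d : nat}.
Implicit Types (P T : cube R d) (x y z : Rn R d).
Local Notation mu := (lebesgue_Rn d : {measure set (Rn R d) -> \bar R}).
Variables (F : Rn R d -> R[i]) (s r : R) (m : cube R d -> R[i]).
Hypotheses (mRe : measurable_fun setT (fun x => complex.Re (F x)))
  (mIm : measurable_fun setT (fun x => complex.Im (F x))).
Hypotheses (s01 : 0 < s < 1) (r1 : 1 <= r).

Definition osc P x : \bar R := (normc (F x - m P))%:E.

Definition osc_weight P : R := 1 / (s `^ (1 + 1 / r) * (side P)%:num `^ s).

Definition step_const : R := 4 * 6 ^+ d + 2 * (2 * d%:R + 2) ^+ d.+1.

Let s0 : 0 < s. Proof. by case/andP: s01. Qed.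
Let r0 : 0 < r. Proof. exact: lt_le_trans r1. Qed.

Lemma step_const_parts : [/\ 1 <= step_const, 4 * 6 ^+ d <= step_const &
  2 * (2 * d%:R + 2) ^+ d.+1 <= step_const].
Proof.
have h1 : 1 <= 6 ^+ d :> R by rewrite exprn_ege1// ler1n.
have h2 : 0 <= 2 * (2 * d%:R + 2) ^+ d.+1 :> R.
  by rewrite mulr_ge0// exprn_ge0// addr_ge0// mulr_ge0.
rewrite /step_const; move: (6 ^+ d) (2 * (2 * d%:R + 2) ^+ d.+1) h1 h2 => u v h1 h2.
by split; lra.
Qed.

Lemma osc_weight_gt0 P : 0 < osc_weight P.
Proof. by rewrite /osc_weight divr_gt0// mulr_gt0// powR_gt0. Qed.

(** The product is the factor in [far_integral]; the weight itself carries one more [1/s], the price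
    of the telescoping. *)
Lemma osc_weightE P : s * osc_weight P = s `^ (- r^-1) * (side P)%:num `^ (- s).
Proof.
rewrite /osc_weight !div1r powRD; last by rewrite (gt_eqF s0) implybT.
by rewrite powRr1 ?(ltW s0)// !invfM !powRN !mulrA divff ?gt_eqF// mul1r.
Qed.

(** Since [2 l(T) <= l(P)], the weight of [P] is at most [2^-s <= 1 - s/2] times that of [T]. *)
Lemma osc_weight_iter P T x n : T = iter n.+1 (sub x) P ->
  s * osc_weight T + 2 * osc_weight P <= 2 * osc_weight T.
Proof.
move=> Tn; have T0 := osc_weight_gt0 T.
suff : osc_weight P <= osc_weight T * (1 - s / 2).
  by move: (osc_weight P) (osc_weight T) T0 => u v; lra.
apply: (@le_trans _ _ (osc_weight T * 2 `^ (- s))); last first.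
  by rewrite ler_wpM2l ?(ltW T0)// powR2N_le.
have sP : 2 `^ s * (side T)%:num `^ s <= (side P)%:num `^ s.
  rewrite -powRM//; apply: ge0_ler_powR; rewrite ?nnegrE ?(ltW s0) ?mulr_ge0//.
  rewrite Tn side_iter mulrCA ger_pMr ?side_gt0// exprS invfM mulrA divff// mul1r.
  by rewrite invf_le1 ?exprn_gt0// exprn_ege1// ler1n.
rewrite /osc_weight !div1r powRN -invfM lef_pV2 ?posrE ?mulr_gt0 ?powR_gt0//.
by rewrite -mulrA ler_wpM2l ?powR_ge0// mulrC.
Qed.

Lemma osc_ge0 P x : (0 <= osc P x)%E.
Proof. by rewrite lee_fin normcE sqrtr_ge0. Qed.

Lemma measurable_osc P : measurable_fun setT (osc P).
Proof. by apply/measurable_EFinP; exact: measurable_fun_normcB. Qed.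

Lemma normcB_sym (a b : R[i]) : normc (a - b) = normc (b - a).
Proof. by rewrite -normcN opprB. Qed.

(** Go from [F x] to [m P] through [m T] and then through [F z], and average over [z] in [T]. *)
Lemma le_osc P T x : hcube T x ->
  (osc P x <= osc T x + emean T (osc T) + emean T (osc P))%E.
Proof.
move=> Tx; rewrite -[emean T (osc T)]mul1e -[emean T (osc P)]mul1e.
apply: le_emean_comb; rewrite ?osc_ge0//; try exact: measurable_osc; try exact: osc_ge0.
move=> z Tz; rewrite !mul1e /osc -!EFinD lee_fin.
apply: le_trans (normcB_triangle _ _ (m T)) _; rewrite -addrA lerD2l.
by apply: le_trans (normcB_triangle _ _ (F z)) _; rewrite (normcB_sym (m T)).
Qed.

Lemma frac_grad_ge0 P x : (0 <= frac_grad s r P F x)%E.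
Proof. exact: poweR_ge0. Qed.

Lemma le_frac_grad P T x n : hcube P x -> T = iter n (sub x) P ->
  (frac_grad s r (triple P) F x <= frac_grad s r (triple T) F x + step_const%:E *
    ((s * osc_weight T)%:E * (osc T x + emean T (osc T)) +
     emean T (frac_grad s r (triple P) F)))%E.
Proof.
move=> Px Tn; have Tx : hcube T x by rewrite Tn; exact: hcube_iter.
have [A1 A2 A3] := step_const_parts.
have q1 : 0 < r^-1 <= 1 by rewrite invr_gt0 r0 invf_le1.
have w0 : 0 <= s * osc_weight T by rewrite mulr_ge0 ?(ltW (osc_weight_gt0 T)) ?(ltW s0).
have mk := measurable_kernel1 mRe mIm s r x.
have split_int : (\int[mu]_(y in cube_set (triple P)) (kernel F s r x y)%:E =
    \int[mu]_(y in cube_set (triple T)) (kernel F s r x y)%:E +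
    \int[mu]_(y in cube_set (triple P) `\` cube_set (triple T)) (kernel F s r x y)%:E)%E.
  have TP : cube_set (triple T) `<=` cube_set (triple P).
    by rewrite Tn; exact: triple_iter.
  rewrite -[in LHS](setDUK TP) ge0_integral_setU//.
  - exact: measurable_cube_set.
  - by apply: measurableD; exact: measurable_cube_set.
  - exact: measurable_funS mk.
  - by move=> y _; rewrite lee_fin kernel_ge0.
  - by rewrite disj_set2E setDIK.
rewrite !frac_gradE split_int.
(* As [1/r <= 1], the root of the sum is at most the sum of the roots; the near part is already the
   first term of the bound. *)
apply: le_trans (poweR_subadditive _ _ q1) _; try exact: int_kernel_ge0.
rewrite leeD2l//.
have mT0 : (0 <= emean T (osc T))%E by apply: emean_ge0; exact: osc_ge0.
have gT0 : (0 <= emean T (frac_grad s r (triple P) F))%E.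
  by apply: emean_ge0; exact: frac_grad_ge0.
have A0 : 0 <= step_const by exact: le_trans A1.
have -> : (step_const%:E * ((s * osc_weight T)%:E * (osc T x + emean T (osc T)) +
     emean T (frac_grad s r (triple P) F)) =
   (step_const * (s * osc_weight T))%:E * osc T x +
   (step_const * (s * osc_weight T))%:E * emean T (osc T) +
   step_const%:E * emean T (frac_grad s r (triple P) F))%E.
  move: (emean T (osc T)) (emean T (frac_grad s r (triple P) F)) mT0 gT0 => a b a0 b0.
  rewrite ge0_muleDr// ?mule_ge0 ?adde_ge0 ?osc_ge0//.
  by rewrite muleA -EFinM [in LHS]ge0_muleDr// osc_ge0.
have Aw0 := mulr_ge0 A0 w0.
apply: le_emean_comb => //.
- exact: measurable_osc.
- exact: osc_ge0.
- exact: measurable_frac_grad.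
- exact: frac_grad_ge0.
- exact: poweR_ge0.
- by apply: mule_ge0; [rewrite lee_fin|exact: osc_ge0].
(* The difference [F x - F z] is at most the oscillation at [x] plus that at [z], both relative to
   [m T]. *)
move=> z Tz; apply: le_trans (far_integral mRe mIm s01 r1 Px Tn Tz) _.
apply: leeD; last first.
  by apply: lee_wpmul2r; [exact: frac_grad_ge0|rewrite lee_fin].
rewrite /osc -!EFinM -EFinD lee_fin -mulrDr -osc_weightE.
apply: ler_pM => //.
- by rewrite mulr_ge0// mulr_ge0// exprn_ge0.
- by rewrite normcE sqrtr_ge0.
- by rewrite ler_wpM2r.
- by rewrite (normcB_sym (F z)) normcB_triangle.
Qed.

End discharge.

(** * Application to the reflected extension of [f] *)

Lemma cube_set_triple (R : realType) (d : nat) (P : cube R d) :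
  cube_set P `<=` cube_set (triple P).
Proof.
move=> x Px i; have /andP[] := Px i; rewrite coord_triple /=.
by have := side_gt0 P => ? ? ?; apply/andP; split; lra.
Qed.

Unset Implicit Arguments.

Theorem theorem3p3 (R : realType) (d : nat) (d_gt0 : (0 < d)%N) :
  exists2 C : R, 0 < C &
    forall (Q : cube R d) (r s : R) (f : Rn R d -> R[i]),
      1 <= r -> 0 < s < 1 -> F_space s r Q f ->
      exists S : set (cube R d),
        [/\ S `<=` dyadic Q, sparse S &
          {ae lebesgue_Rn d, forall x, cube_set Q x ->
            (frac_grad s r Q f x <= C%:E *
              \esum_(P in S)
                (emean P (frac_grad s r (triple P) (reflect_ext Q f)) +
                 (1 / (s `^ (1 + 1 / r) * (side P)%:num `^ s))%:E *
                 emean P (fun z => (normc (f z - cmean P f))%:E)) *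
                (\1_(cube_set P) x)%:E)%E}].
Proof.
have [A1 _ _] := @step_const_parts R d.
(* The constant of [sparse_domination] for [A = step_const], fixed by [d] before [Q], [r], [s] and
   [f] are chosen. *)
exists (2 * (2 * step_const (R := R) (d := d) * (4 * 2 ^+ d))).
  by rewrite !mulr_gt0 ?exprn_gt0//; exact: lt_le_trans A1.
move=> Q r s f r1 s01 [fL1 _]; have [mRe mIm] := measurable_reflect_ext fL1.
set F := reflect_ext Q f in mRe mIm *.
have FQ x : cube_set Q x -> F x = f x by move=> Qx; rewrite /F /reflect_ext /= fold_id.
have [||||||||||S [SQ Ssp Sae]] := @sparse_domination R d Q
  (fun P => frac_grad s r (triple P) F) (osc F (cmean^~ f)) (osc_weight s r)
  (step_const (R := R) (d := d)) s.
- exact: A1.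
- by case/andP: s01.
- by move=> P; apply: osc_weight_gt0 => //; case/andP: s01.
- by move=> P; exact: measurable_frac_grad.
- by move=> P; exact: measurable_osc.
- by move=> P x; exact: frac_grad_ge0.
- by move=> P x; exact: osc_ge0.
- by move=> P T x n; exact: osc_weight_iter.
- by move=> P T x n Px ->; apply: le_osc => //; exact: hcube_iter.
- by move=> P T x n Px; exact: le_frac_grad.
exists S; split; [exact: SQ|exact: Ssp|].
move: Sae; apply: filterS => x dom Qx.
(* The extension agrees with [f] on [Q], and [Q] lies in [3Q]. *)
have fF : (frac_grad s r Q f x <= frac_grad s r (triple Q) F x)%E.
  rewrite /frac_grad (eq_integral (fun y => (kernel F s r x y)%:E)) => [|y]; last first.
    by rewrite inE => Qy; rewrite /kernel !FQ.
  have k0 y : (0 <= (kernel F s r x y)%:E)%E by rewrite lee_fin kernel_ge0.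
  have r0 : 0 <= r^-1 by rewrite invr_ge0; exact: le_trans r1.
  apply: (gt0_ler_poweR r0).
  - by rewrite in_itv/= leey andbT integral_ge0.
  - by rewrite in_itv/= leey andbT int_kernel_ge0.
  apply: ge0_subset_integral => //; try exact: measurable_cube_set.
  - exact: measurable_funS (measurable_kernel1 mRe mIm s r x).
  - exact: cube_set_triple.
apply: le_trans fF _; apply: le_trans (dom Qx) _.
(* The two sums are equal: each selected [P] lies in [Q], where [F] is [f], so the oscillation means
   coincide. *)
rewrite le_eqVlt; apply/orP; left; apply/eqP; congr (_ * _)%E.
apply: eq_esum => P SP; congr ((_ + _ * _) * _)%E; congr (_ / _)%E.
apply: eq_integral => y; rewrite inE => Py.
by rewrite /osc FQ//; apply: cube_set_dyadic Py; exact: SQ.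
Qed.
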